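(* Let $\Sigma,\Delta$ be finite alphabets. If $S$ is a set of immersions from $F(\Sigma)$ to $F(\Delta)$, then there exist a finite alphabet $\Sigma_S$ and an immersion $\psi_S:F(\Sigma_S)\to F(\Sigma)$ such that $\operatorname{Image}(\psi_S)=\operatorname{Eq}(S)$. Moreover, there exists an algorithm which, given as input a finite set $S$ of immersions from $F(\Sigma)$ to $F(\Delta)$, outputs such an immersion $\psi_S$.
   Context: For a finite alphabet $\Sigma$ (possibly empty), $F(\Sigma)$ is the free group on $\Sigma$, viewed as the set of freely reduced words over $\Sigma\cup\Sigma^{-1}$. A group morphism $f:F(\Sigma)\to F(\Delta)$ is an immersion if for every $x\in\Sigma\cup\Sigma^{-1}$ the freely reduced word $f(x)$ is non-empty and, for distinct $x,y\in\Sigma\cup\Sigma^{-1}$, the freely reduced words $f(x)$ and $f(y)$ start with different letters of $\Delta\cup\Delta^{-1}$. For morphisms $g,h:F(\Sigma)\to F(\Delta)$ put $\operatorname{Eq}(g,h)=\{x\in F(\Sigma)\mid g(x)=h(x)\}$, and for a set $S$ of morphisms put $\operatorname{Eq}(S)=\bigcap_{g,h\in S}\operatorname{Eq}(g,h)$. For algorithmic purposes a morphism $f:F(\Sigma)\to F(\Delta)$ is given as the list of reduced words $(f(a))_{a\in\Sigma}$. *)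

(* Defs.v *)
From HB Require Import structures.
From mathcomp Require Import all_boot.
From mathcomp Require Import classical_sets.

Set Implicit Arguments.
Unset Strict Implicit.
Unset Printing Implicit Defensive.

Local Open Scope group_scope.
Local Open Scope classical_set_scope.

(** * Free groups as groups of freely reduced words *)

(* [(a, false)] is the letter [a] and [(a, true)] is its formal inverse, so
   that [letter A] is the disjoint union of [A] and [A^-1]. *)
Definition letter (A : Type) : Type := (A * bool)%type.

Definition letter_inv A (x : letter A) : letter A := (x.1, ~~ x.2).

Section FreeGroup.
Variable A : choiceType.
Implicit Types (x y : letter A) (u v w : seq (letter A)).

Definition reduced w : bool := sorted (fun x y => y != letter_inv x) w.

Definition cons_reduce x w : seq (letter A) :=
  if w is y :: w' then if y == letter_inv x then w' else x :: w else [:: x].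

Definition reduce w : seq (letter A) := foldr cons_reduce [::] w.

Record free_group : Type :=
  FreeGroup { fg_word :> seq (letter A); _ : reduced fg_word }.

HB.instance Definition _ := [isSub for fg_word].
HB.instance Definition _ := [Choice of free_group by <:].

Lemma letter_invK : involutive (@letter_inv A).
Proof. by case=> a b; rewrite /letter_inv /= negbK. Qed.

Lemma cons_reduce_reduced x w : reduced w -> reduced (cons_reduce x w).
Proof.
case: w => [|y w] //= rw; case: ifPn => [_|nyx]; first exact: path_sorted rw.
by rewrite /reduced /= nyx.
Qed.

Lemma foldr_reduced u w : reduced w -> reduced (foldr cons_reduce w u).
Proof. by move=> rw; elim: u => //= x u; apply: cons_reduce_reduced. Qed.

Lemma cons_reduceK x w :
  reduced w -> cons_reduce x (cons_reduce (letter_inv x) w) = w.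
Proof.
case: w => [|y w] /=; first by rewrite eqxx.
rewrite letter_invK; case: eqP => [-> |_] rw /=; last by rewrite eqxx.
by case: w rw => //= z w /andP[/negPf-> _].
Qed.

Lemma foldr_cons_reduce x u w : reduced w ->
  foldr cons_reduce w (cons_reduce x u) = cons_reduce x (foldr cons_reduce w u).
Proof.
move=> rw; case: u => [|y u] //=; case: eqP => [->|] //.
by rewrite cons_reduceK // foldr_reduced.
Qed.

Lemma foldr_foldr u v w : reduced w ->
  foldr cons_reduce w (foldr cons_reduce v u)
  = foldr cons_reduce (foldr cons_reduce w v) u.
Proof. by move=> rw; elim: u => //= x u IH; rewrite foldr_cons_reduce // IH. Qed.

Lemma reduceE w : reduced w -> reduce w = w.
Proof.
elim: w => //= x w IH rw; rewrite IH; last exact: path_sorted rw.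
by case: w rw {IH} => //= y w /andP[/negPf-> _].
Qed.

Lemma reduce_reduced w : reduced (reduce w).
Proof. exact: foldr_reduced. Qed.

Lemma reduce_cat u v : reduced v -> reduce (u ++ v) = foldr cons_reduce v u.
Proof. by move=> rv; rewrite /reduce foldr_cat -/(reduce v) reduceE. Qed.

Lemma fg_wordP (g : free_group) : reduced g.
Proof. by case: g. Qed.

Definition word_inv w : seq (letter A) := rev [seq letter_inv x | x <- w].

Lemma word_inv_reduced w : reduced w -> reduced (word_inv w).
Proof.
move=> rw; rewrite /reduced /word_inv rev_sorted sorted_map.
rewrite (@eq_sorted _ _ (fun x y => y != letter_inv x)) // => x y /=.
by rewrite letter_invK eq_sym.
Qed.

Definition fg_one : free_group := FreeGroup (isT : reduced [::]).
Definition fg_mul (g h : free_group) : free_group :=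
  FreeGroup (reduce_reduced (g ++ h)).
Definition fg_inv (g : free_group) : free_group :=
  FreeGroup (word_inv_reduced (fg_wordP g)).

Lemma fg_mulA : associative fg_mul.
Proof.
move=> g h k; apply: val_inj => /=; have := (fg_wordP g, fg_wordP h, fg_wordP k).
case=> [[rg rh] rk]; rewrite !reduce_cat ?foldr_reduced //.
by rewrite foldr_foldr.
Qed.

Lemma fg_mul1 : left_id fg_one fg_mul.
Proof. by move=> g; apply: val_inj; rewrite /= reduceE // fg_wordP. Qed.

Lemma fg_mulr1 : right_id fg_one fg_mul.
Proof. by move=> g; apply: val_inj; rewrite /= cats0 reduceE // fg_wordP. Qed.

Lemma fg_mulrV : right_inverse fg_one fg_inv fg_mul.
Proof.
have cancel w : forall t, reduced t ->
    foldr cons_reduce (foldr cons_reduce t (word_inv w)) w = t.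
  elim: w => //= x w IH t rt.
  rewrite /word_inv map_cons rev_cons -cats1 foldr_cat.
  by rewrite IH ?cons_reduce_reduced // cons_reduceK.
move=> g; apply: val_inj => /=.
rewrite reduce_cat ?word_inv_reduced ?fg_wordP //.
by rewrite -[word_inv g]reduceE ?word_inv_reduced ?fg_wordP // cancel.
Qed.

Lemma fg_invK : involutive fg_inv.
Proof.
move=> g; apply: val_inj; rewrite /= /word_inv map_rev revK -map_comp.
by rewrite (eq_map (@letter_invK)) map_id.
Qed.

Lemma fg_mulVr : left_inverse fg_one fg_inv fg_mul.
Proof. by move=> g; rewrite -{2}(fg_invK g) fg_mulrV. Qed.

HB.instance Definition _ := isGroup.Build free_group
  fg_mulA fg_mul1 fg_mulr1 fg_mulVr fg_mulrV.

Definition fg_letter (x : letter A) : free_group :=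
  FreeGroup (isT : reduced [:: x]).

End FreeGroup.

(** * Immersions and equalisers *)

Section Immersions.
Variables Sigma Delta : finType.
Local Notation morphism :=
  {multiplicative free_group Sigma -> free_group Delta}.

Definition immersion (f : morphism) : Prop :=
  (forall x : letter Sigma, fg_word (f (fg_letter x)) <> [::]) /\
  (forall x y : letter Sigma, x <> y ->
     ohead (fg_word (f (fg_letter x))) <> ohead (fg_word (f (fg_letter y)))).

Definition equaliser (g h : morphism) : set (free_group Sigma) :=
  [set x | g x = h x].

(* The empty intersection is the whole of [free_group Sigma]. *)
Definition set_equaliser (S : set morphism) : set (free_group Sigma) :=
  \bigcap_(g in S) \bigcap_(h in S) equaliser g h.

End Immersions.

(** * Algorithms: WHILE programs over binary trees *)

(* Algorithms are programs of (a point-free, one-variable form of) the WHILE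
   language of N. Jones, whose data are unlabelled binary trees.  It is
   Turing-complete: numbers, pairs and lists are coded as trees in the manner
   of Lisp, and [PWhile] provides unbounded iteration. *)
Inductive tree : Type := Nil | Cons of tree & tree.

Inductive program : Type :=
| PId
| PNil
| PHead
| PTail
| PCons of program & program
| PSeq of program & program
| PIf of program & program & program
| PWhile of program & program.

Definition head_tree (t : tree) : tree := if t is Cons u _ then u else Nil.
Definition tail_tree (t : tree) : tree := if t is Cons _ v then v else Nil.

(* [exec p t u]: on input [t], the program [p] halts with output [u].
   [PSeq p q] runs [p], then [q] on its output; [Nil] means false. *)
Inductive exec : program -> tree -> tree -> Prop :=
| exec_id t : exec PId t t
| exec_nil t : exec PNil t Nil
| exec_head t : exec PHead t (head_tree t)
| exec_tail t : exec PTail t (tail_tree t)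
| exec_cons p q t u v :
    exec p t u -> exec q t v -> exec (PCons p q) t (Cons u v)
| exec_seq p q t u v : exec p t u -> exec q u v -> exec (PSeq p q) t v
| exec_if_true b p q t u1 u2 v :
    exec b t (Cons u1 u2) -> exec p t v -> exec (PIf b p q) t v
| exec_if_false b p q t v :
    exec b t Nil -> exec q t v -> exec (PIf b p q) t v
| exec_while_stop b p t : exec b t Nil -> exec (PWhile b p) t t
| exec_while_step b p t u1 u2 u v :
    exec b t (Cons u1 u2) -> exec p t u -> exec (PWhile b p) u v ->
    exec (PWhile b p) t v.

Lemma exec_functional p t u v : exec p t u -> exec p t v -> u = v.
Proof.
move=> pu; elim: pu v => {p t u}.
- by move=> t v pv; inversion pv.
- by move=> t v pv; inversion pv.
- by move=> t v pv; inversion pv.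
- by move=> t v pv; inversion pv.
- move=> p q t u v _ IHp _ IHq w pw; inversion pw; subst.
  by congr Cons; [apply: IHp | apply: IHq].
- move=> p q t u v _ IHp _ IHq w pw; inversion pw as [| | | | |? ? ? u' ? pu' qw| | | |]; subst.
  by apply: IHq; rewrite (IHp _ pu').
- move=> b p q t u1 u2 v _ IHb _ IHp w pw; inversion pw; subst; first exact: IHp.
  by have := IHb _ ltac:(eassumption).
- move=> b p q t v _ IHb _ IHp w pw; inversion pw; subst; last exact: IHp.
  by have := IHb _ ltac:(eassumption).
- move=> b p t _ IHb w pw; inversion pw; subst => //.
  by have := IHb _ ltac:(eassumption).
- move=> b p t u1 u2 u v _ IHb _ IHp _ IHw w pw.
  inversion pw as [| | | | | | | |? ? ? bt|? ? ? ? ? u' ? bt pu' ww]; subst.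
    by have := IHb _ bt.
  by apply: IHw; rewrite (IHp _ pu').
Qed.

(** * Encoding of words and morphisms as trees *)

Definition encode_nat (n : nat) : tree := iter n (Cons Nil) Nil.

Definition encode_bool (b : bool) : tree := if b then Cons Nil Nil else Nil.

Definition encode_seq (s : seq tree) : tree := foldr Cons Nil s.

(* The letters of a finite alphabet are numbered by the library's standard
   enumeration; for ['I_n] this is the usual numbering. *)
Definition encode_letter (A : finType) (x : letter A) : tree :=
  Cons (encode_nat (enum_rank x.1)) (encode_bool x.2).

Definition encode_word (A : finType) (w : seq (letter A)) : tree :=
  encode_seq [seq encode_letter x | x <- w].

(* The list of the reduced words [f a], for [a] in [A]. *)
Definition encode_morphism (A B : finType)
    (f : {multiplicative free_group A -> free_group B}) : tree :=
  encode_seq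
    [seq encode_word (fg_word (f (fg_letter (a, false)))) | a <- enum A].

(* The sizes of both alphabets are part of the input, as they cannot always be
   read off from the morphisms (the list may be empty, for instance). *)
Definition encode_input (A B : finType)
    (s : seq {multiplicative free_group A -> free_group B}) : tree :=
  Cons (encode_nat #|A|) (Cons (encode_nat #|B|)
    (encode_seq [seq encode_morphism f | f <- s])).

(* Main.v *)
From HB Require Import structures.
Require Import Defs.
From Stdlib Require List.
From mathcomp Require Import all_boot.
From mathcomp Require Import boolp classical_sets.
From mathcomp Require Import zify.

(** An immersion maps a reduced word to the concatenation of the images of its
letters, without any cancellation.  On reduced words it is therefore a
substitution [ext f] of words for letters, in which different letters have
images with different first letters ([marked]).  Such a substitution commutes
with longest common prefixes ([ext_lcp]): where two words first differ, so do
their images.  Hence the words on which all members of a family of immersions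
agree are closed under products, left cancellation and longest common prefixes
([agreeing_submonoid]).  In such a set the shortest word that begins with a
given letter is a prefix of all the others that begin with it ([base_prefix]),
so that every element factors into these shortest words, of which there is at
most one for each first letter.  The inverse of a shortest word in the
equaliser is again one, and no nontrivial reduced word is its own inverse.
Keeping one word of each pair [w], [w^-1] gives a finite basis in which the
words and their inverses have different first letters, that is, an immersion
with the equaliser as its image ([basis_map_immersion], [basis_map_range]).

To compute this basis it is enough to bound the lengths of the shortest words
computably, since all words up to the bound can then be searched.  For a pair
[(g, h)], consider the pullback of the pairs [(u, v)] with [g(u) = h(v)].  It
is generated by its minimal pairs, one for each first letter [a] of [u]; these
pairs define a new marked pair [(g', h')] with [g' a = u] and [h' a = v], and
the words on which [g] and [h] agree are the [g']-images of the words on which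
[g'] and [h'] agree ([derived_descend], [derived_ascend]).  This derivation is
iterated.

- The number of proper suffixes of the words [g a] and [h a] does not increase
  ([complexity_derived]), so that all derived pairs belong to a finite set of
  known size.
- The length of the shortest solution that begins with [x] decreases strictly,
  unless the letter [x] is itself a solution of the derived pair
  ([shortest_length_derived]).

So no pair recurs before [x] becomes a solution, which happens after at most as
many derivations as there are pairs; undoing the derivations multiplies lengths
by a bounded factor each time ([pair_solution_bound]).  A finite family is
treated by adding its members one at a time and substituting the basis found so
far ([family_solution_bound]).

The resulting search is written with list functions that are assembled from a
few operations closed under composition and bounded iteration, each of which is
realised by a program ([computable_solve]).  It runs on numbered letters; an
injective numbering of the letters does not affect its result. *)

Set Implicit Arguments.
Unset Strict Implicit.
Unset Printing Implicit Defensive.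

(** * Words, common prefixes and marked substitutions *)

Section CommonPrefix.
Variable A : eqType.
Implicit Types u v w s : seq A.

Fixpoint lcp u v : seq A :=
  match u, v with
  | a :: u', b :: v' => if a == b then a :: lcp u' v' else [::]
  | _, _ => [::]
  end.

Lemma lcpC u v : lcp u v = lcp v u.
Proof.
elim: u v => [|a u IH] [|b v] //=; rewrite eq_sym; case: eqP => // ->.
by rewrite IH.
Qed.

Lemma lcpuu u : lcp u u = u.
Proof. by elim: u => //= a u ->; rewrite eqxx. Qed.

Lemma lcp_prefixl u v : prefix (lcp u v) u.
Proof. by elim: u v => [|a u IH] [|b v] //=; case: eqP => //= _; rewrite eqxx IH. Qed.

Lemma lcp_prefixr u v : prefix (lcp u v) v.
Proof. by rewrite lcpC lcp_prefixl. Qed.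

Lemma lcp_cat s u v : lcp (s ++ u) (s ++ v) = s ++ lcp u v.
Proof. by elim: s => //= a s ->; rewrite eqxx. Qed.

Lemma ohead_lcp u v : ohead u = ohead v -> ohead (lcp u v) = ohead u.
Proof. by case: u v => [|a u] [|b v] //= [->]; rewrite eqxx. Qed.

Lemma lcp_ohead_neq u v : ohead u <> ohead v -> lcp u v = [::].
Proof. by case: u v => [|a u] [|b v] //=; case: eqP => // ->. Qed.

Lemma prefix_size_eq u v : prefix u v -> size v <= size u -> u = v.
Proof.
move=> /prefixP[s ->]; rewrite size_cat -[X in _ <= X]addn0 leq_add2l leqn0.
by move=> /nilP ->; rewrite cats0.
Qed.

Lemma prefix_ohead u v : prefix u v -> u != [::] -> ohead u = ohead v.
Proof. by move=> /prefixP[s ->]; case: u. Qed.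

End CommonPrefix.

Section Extension.
Variables A B : eqType.
Implicit Types (g : A -> seq B) (u v w : seq A).

Definition ext g w : seq B := flatten (map g w).

(** An empty image encodes that a substitution is undefined at a letter. *)
Definition defined_on g w : bool := all (fun a => g a != [::]) w.

Definition marked g : Prop :=
  forall a b, g a != [::] -> ohead (g a) = ohead (g b) -> a = b.

Lemma ext_cons g a w : ext g (a :: w) = g a ++ ext g w.
Proof. by []. Qed.

Lemma ext_cat g u v : ext g (u ++ v) = ext g u ++ ext g v.
Proof. by rewrite /ext map_cat flatten_cat. Qed.

Lemma defined_on_cat g u v : defined_on g (u ++ v) = defined_on g u && defined_on g v.
Proof. exact: all_cat. Qed.

Lemma defined_on_prefix g u v : prefix u v -> defined_on g v -> defined_on g u.
Proof. by move=> /prefixP[s ->]; rewrite defined_on_cat => /andP[]. Qed.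

Lemma size_ext g w : defined_on g w -> size w <= size (ext g w).
Proof.
elim: w => //= a w IH /andP[ga /IH]; rewrite ext_cons size_cat.
by case: (g a) ga => //= b s _ le; rewrite ltnS (leq_trans le) // leq_addl.
Qed.

Lemma size_ext_le g w n : (forall a, size (g a) <= n) ->
  size (ext g w) <= size w * n.
Proof.
by move=> le; elim: w => //= a w IH; rewrite ext_cons size_cat mulSn leq_add.
Qed.

Lemma ext_eq0 g w : defined_on g w -> ext g w = [::] -> w = [::].
Proof. by move=> /size_ext + e; rewrite e leqn0 => /nilP. Qed.

Lemma ohead_ext g a w : g a != [::] -> ohead (ext g (a :: w)) = ohead (g a).
Proof. by rewrite ext_cons; case: (g a). Qed.

(** Where two words first differ, the images begin with different letters. *)
Lemma ext_lcp g u v : marked g -> defined_on g u -> defined_on g v ->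
  ext g (lcp u v) = lcp (ext g u) (ext g v).
Proof.
move=> mg; elim: u v => [|a u IH] [|b v] //=; first by rewrite lcpC.
move=> /andP[ga ou] /andP[gb ov]; case: eqP => [e|ne].
  by rewrite -e !ext_cons lcp_cat IH.
rewrite lcp_ohead_neq // !ohead_ext // => /mg e; exact: ne (e ga).
Qed.

Lemma ext_inj g u v : marked g -> defined_on g u -> defined_on g v ->
  ext g u = ext g v -> u = v.
Proof.
move=> mg; have half u1 v1 : defined_on g u1 -> defined_on g v1 -> ext g u1 = ext g v1 ->
    u1 = lcp u1 v1.
  move=> ou ov e; have := ext_lcp mg ou ov; rewrite -e lcpuu.
  have /prefixP[s E] := lcp_prefixl u1 v1.
  move: ou; rewrite {1 3}E defined_on_cat ext_cat => /andP[_ os] /esym/(congr1 size).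
  rewrite size_cat -[RHS]addn0 => /addnI/size0nil/(ext_eq0 os) s0.
  by rewrite {1}E s0 cats0.
by move=> ou ov e; rewrite (half u v) // lcpC -half.
Qed.

End Extension.

Section Submonoids.
Variable A : choiceType.
Implicit Types (E : seq A -> Prop) (u v w : seq A) (x a : A).

(** The closure properties shared by all solution sets below.  Closure under longest
common prefixes is what makes a set of words freely generated by words with
different first letters. *)
Record lcp_submonoid E : Prop := LcpSubmonoid {
  lcp_submonoid1 : E [::];
  lcp_submonoidM u v : E u -> E v -> E (u ++ v);
  lcp_submonoidK u v : E u -> E (u ++ v) -> E v;
  lcp_submonoidI u v : E u -> E v -> E (lcp u v) }.

Definition shortest E x w : Prop :=
  [/\ E w, ohead w = Some x &
      forall v, E v -> ohead v = Some x -> size w <= size v].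

(** The generator with first letter [x]; empty if no word of [E] begins with [x]. *)
Definition base E x : seq A := xget [::] [set w | shortest E x w].

Lemma shortest_ex E x v : E v -> ohead v = Some x -> exists w, shortest E x w.
Proof.
move: {2}(size v) (leqnn (size v)) => n; elim: n v => [|n IH] v.
  by rewrite leqn0 => /nilP ->.
move=> le Ev hv; case: (pselect (exists2 u, E u & ohead u = Some x /\ size u < size v)).
  by move=> [u Eu [hu lt]]; apply: (IH u) => //; rewrite -ltnS (leq_trans lt).
move=> nu; exists v; split=> // u Eu hu; rewrite leqNgt; apply/negP => lt.
by apply: nu; exists u.
Qed.

Lemma base_shortest E x v : E v -> ohead v = Some x -> shortest E x (base E x).
Proof. by move=> Ev hv; apply: xgetPex; apply: shortest_ex Ev hv. Qed.

Lemma baseP E x : base E x != [::] -> shortest E x (base E x).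
Proof. by rewrite /base; case: xgetP => [w _ //|_]; rewrite eqxx. Qed.

Lemma base_neq0 E x v : E v -> ohead v = Some x -> base E x != [::].
Proof. by move=> Ev hv; case: (base_shortest Ev hv) => _; case: (base E x). Qed.

Lemma base_ohead E x : base E x != [::] -> ohead (base E x) = Some x.
Proof. by case/baseP. Qed.

Lemma marked_base E : marked (base E).
Proof.
move=> a b na e; have := base_ohead na; rewrite e => e'.
have nb : base E b != [::] by case: (base E b) e'.
by move: e'; rewrite base_ohead // => -[].
Qed.

Variable E : seq A -> Prop.
Hypothesis closedE : lcp_submonoid E.

(** Otherwise the common prefix would be a shorter word with the same first letter. *)
Lemma base_prefix x v : E v -> ohead v = Some x -> prefix (base E x) v.
Proof.
move=> Ev hv; have [Eb hb min] := base_shortest Ev hv.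
have <- : lcp (base E x) v = base E x; last exact: lcp_prefixr.
apply: prefix_size_eq; first exact: lcp_prefixl.
apply: min; first exact: (lcp_submonoidI closedE).
by rewrite ohead_lcp hb.
Qed.

(** The generator with the right first letter can be split off, and what remains is
in [E] by cancellation. *)
Lemma base_decompose w : E w -> exists2 w', defined_on (base E) w' & ext (base E) w' = w.
Proof.
move: {2}(size w) (leqnn (size w)) => n; elim: n w => [|n IH] w.
  by rewrite leqn0 => /nilP -> _; exists [::].
case: w => [|x w] le Ew; first by exists [::].
have hx : ohead (x :: w) = Some x by [].
have /prefixP[s es] := base_prefix Ew hx; have nb := base_neq0 Ew hx.
have [Eb _ _] := baseP nb.
have Es : E s by apply: (lcp_submonoidK closedE) Eb _; rewrite -es.
have [|w' ow' ew'] := IH s _ Es.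
  move: (congr1 size es) le; rewrite size_cat /=.
  case: (base E x) nb => //= b t _; rewrite addSn => -[->].
  by rewrite ltnS; apply: leq_trans; rewrite leq_addl.
by exists (x :: w'); rewrite /= ?nb // ext_cons ew' es.
Qed.

Lemma base_compose w : defined_on (base E) w -> E (ext (base E) w).
Proof.
elim: w => [_|x w IH /= /andP[nx ow]]; first exact: (lcp_submonoid1 closedE).
have [Ex _ _] := baseP nx; rewrite ext_cons.
by apply: (lcp_submonoidM closedE) => //; apply: IH.
Qed.

End Submonoids.

(** * The pullback of two marked substitutions *)

Lemma cat_eq_cat (T : Type) (s1 s2 t1 t2 : seq T) :
  s1 ++ t1 = s2 ++ t2 -> size s1 <= size s2 ->
  exists2 r, s2 = s1 ++ r & t1 = r ++ t2.
Proof.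
elim: s1 s2 => [|a s1 IH] [|b s2] //= e le; first by exists [::].
  by exists (b :: s2).
by case: e => -> /IH[//|r -> ->]; exists r.
Qed.

Section Agreement.
Variables (A A' C : eqType) (g : A -> seq C) (h : A' -> seq C).

Definition agree u v : Prop := [/\ defined_on g u, defined_on h v & ext g u = ext h v].

(** A minimal pair of the pullback.  Minimality is imposed on both components at
once, so that the notion is symmetric in [g] and [h]. *)
Definition block u v : Prop :=
  [/\ agree u v, u != [::] &
      forall u0 v0, prefix u0 u -> prefix v0 v -> agree u0 v0 ->
        u0 != [::] -> u0 = u /\ v0 = v].

Lemma agree_eq0 u v : agree u v -> (u == [::]) = (v == [::]).
Proof.
case=> ou ov e; apply/eqP/eqP => z; move: e; rewrite z => e.
  by apply: ext_eq0 ov _; rewrite -e.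
by apply: ext_eq0 ou _; rewrite e.
Qed.

Lemma agree_cat u v u' v' : agree u v -> agree u' v' -> agree (u ++ u') (v ++ v').
Proof.
move=> [ou ov e] [ou' ov' e']; split; rewrite ?defined_on_cat ?ou ?ov //.
by rewrite !ext_cat e e'.
Qed.

Lemma agree_cancel u v u' v' :
  agree u v -> agree (u ++ u') (v ++ v') -> agree u' v'.
Proof.
move=> [_ _ e] []; rewrite !defined_on_cat !ext_cat => /andP[_ ou'] /andP[_ ov'].
by rewrite e => /eqP; rewrite eqseq_cat // eqxx => /eqP.
Qed.

Hypotheses (mg : marked g) (mh : marked h).

Lemma agree_lcp u v u' v' :
  agree u v -> agree u' v' -> agree (lcp u u') (lcp v v').
Proof.
move=> [ou ov e] [ou' ov' e'].
split; first exact: defined_on_prefix (lcp_prefixl _ _) ou.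
  exact: defined_on_prefix (lcp_prefixl _ _) ov.
by rewrite !ext_lcp // e e'.
Qed.

(** A cut in an image falls inside or at the end of the image of one letter [c]. *)
Lemma ext_split u X Y : ext g u = X ++ Y -> X != [::] ->
  exists p c q y z, [/\ u = p ++ c :: q, g c = y ++ z, y != [::],
    X = ext g p ++ y & Y = z ++ ext g q].
Proof.
elim: u X => [|a u IH] X; first by case: X.
rewrite ext_cons => e nX; have [le|lt] := leqP (size X) (size (g a)).
  have [z gc eY] := cat_eq_cat (esym e) le.
  by exists [::], a, u, X, z.
have [X' eX e'] := cat_eq_cat e (ltnW lt).
have nX' : X' != [::] by apply: contraTneq lt => z; rewrite eX z cats0 ltnn.
have [p [c [q [y [z [-> gc ny Ex ->]]]]]] := IH _ e' nX'.
by exists (a :: p), c, q, y, z; split; rewrite // eX Ex ext_cons catA.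
Qed.

(** What is still to be read of a minimal pair at a moment when the first component
is ahead of the second by [z]. *)
Definition remainder z t q : Prop :=
  [/\ defined_on g q, defined_on h t, ext h t = z ++ ext g q &
      forall q0 t0, prefix q0 q -> prefix t0 t ->
        ext h t0 = z ++ ext g q0 -> t0 = t].

(** Two ways of catching up with [z] have a common prefix that catches up as well,
and minimality identifies it with both. *)
Lemma remainder_inj z t q t' q' :
  remainder z t q -> remainder z t' q' -> t = t'.
Proof.
move=> [oq ot e min] [oq' ot' e' min'].
have E : ext h (lcp t t') = z ++ ext g (lcp q q').
  by rewrite !ext_lcp // e e' lcp_cat.
rewrite -(min _ _ (lcp_prefixl _ _) (lcp_prefixl _ _) E).
exact: (min' _ _ (lcp_prefixr _ _) (lcp_prefixr _ _) E).
Qed.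

(** The image of [s] ends inside the image of a letter [c], since otherwise the pair
could be cut at [s]. *)
Lemma block_remainder u v s t : block u v -> v = s ++ t ->
  s != [::] -> t != [::] ->
  exists c y z q, [/\ g c = y ++ z, y != [::], z != [::] & remainder z t q].
Proof.
move=> [[ou ov e] nu min] ev ns nt.
move: ov; rewrite ev defined_on_cat => /andP[os ot].
have nX : ext h s != [::] by apply: contraNneq ns => /(ext_eq0 os) ->.
move: e; rewrite ev ext_cat => /ext_split/(_ nX).
move=> [p [c [q [y [z [eu gc ny eX eY]]]]]].
move: ou; rewrite eu defined_on_cat /= => /and3P[op nc oq].
exists c, y, z, q; split=> //.
  apply: contraNneq nt => z0.
  have [||||_] := min (p ++ [:: c]) s.
  - by rewrite eu -[c :: q]cat1s catA prefix_prefix.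
  - by rewrite ev prefix_prefix.
  - split=> //; first by rewrite defined_on_cat op /= nc.
    by rewrite eX ext_cat ext_cons gc z0 !cats0.
  - by case: (p).
  by rewrite ev -[LHS]cats0 => /eqP; rewrite eqseq_cat // eqxx => /eqP <-.
split=> // q0 t0 /prefixP[q1 eq] /prefixP[t1 et] e0.
have [||||_] := min (p ++ c :: q0) (s ++ t0).
- by rewrite eu eq -[_ :: (_ ++ _)]cat_cons catA prefix_prefix.
- by rewrite ev et catA prefix_prefix.
- split.
  + by move: oq; rewrite eq !defined_on_cat /= op nc => /andP[->].
  + by move: ot; rewrite et !defined_on_cat os => /andP[->].
  + by rewrite !ext_cat ext_cons e0 eX gc !catA.
- by case: (p).
by rewrite ev => /eqP; rewrite eqseq_cat // eqxx => /eqP.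
Qed.

End Agreement.

Definition has_suffixes (A B : eqType) (S : seq (seq B)) (g : A -> seq B) :=
  forall a s t, g a = s ++ t -> s != [::] -> t != [::] -> t \in S.

(** A suffix of the second component of a minimal pair is determined by the suffix
[z] of a [g]-word by which the first component is then ahead, so there are no more
of the former than of the latter. *)
Lemma block_suffixes (A C : eqType) (A' : choiceType) (g : A -> seq C) (h : A' -> seq C) S :
  marked g -> marked h -> has_suffixes S g ->
  exists2 S' : seq (seq A'), size S' = size S &
    forall u v, block g h u v -> forall s t, v = s ++ t ->
      s != [::] -> t != [::] -> t \in S'.
Proof.
move=> mg mh hS; pose f z := xget [::] [set t | exists q, remainder g h z t q].
exists (map f S); first by rewrite size_map.
move=> u v b s t ev ns nt.
have [c [y [z [q [gc ny nz R]]]]] := block_remainder b ev ns nt.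
apply/mapP; exists z; first exact: hS gc ny nz.
apply/esym/xget_unique; first by exists q.
by move=> t' [q' R']; apply: remainder_inj R' R.
Qed.

Lemma agree_sym (A A' C : eqType) (g : A -> seq C) (h : A' -> seq C) u v :
  agree g h u v -> agree h g v u.
Proof. by case. Qed.

Lemma block_sym (A A' C : eqType) (g : A -> seq C) (h : A' -> seq C) u v :
  block g h u v -> block h g v u.
Proof.
case=> a nu min; split; first exact: agree_sym.
  by rewrite -(agree_eq0 a).
move=> v0 u0 pv pu /agree_sym a0 nv.
by have [|-> ->] := min u0 v0 pu pv a0; first by rewrite (agree_eq0 a0).
Qed.

Definition solution (A B : eqType) (gh : (A -> seq B) * (A -> seq B)) w : Prop :=
  agree gh.1 gh.2 w w.

Section Derived.
Variables (A : choiceType) (B : eqType) (g h : A -> seq B).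

(** The derived pair maps [a] to the minimal pair whose first component begins with
[a].  Indexing by that letter keeps the alphabet unchanged under derivation, so
that derived pairs can be compared. *)
Definition derived_l : A -> seq A := base (fun u => exists v, agree g h u v).

Definition derived_r a : seq A :=
  if derived_l a == [::] then [::] else xget [::] [set v | agree g h (derived_l a) v].

Hypotheses (mg : marked g) (mh : marked h).

Lemma agree_functional u v v' : agree g h u v -> agree g h u v' -> v = v'.
Proof. by move=> [_ ov e] [_ ov' e']; apply: ext_inj mh _ _ _; rewrite // -e. Qed.

(** Only the first components are recorded: each determines the second one. *)
Lemma pullback_submonoid : lcp_submonoid (fun u => exists v, agree g h u v).
Proof.
split.
- by exists [::].
- by move=> u u' [v a] [v' a']; exists (v ++ v'); apply: agree_cat.
- move=> u u' [v a] [v' a'].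
  have e : lcp v v' = v.
    have := agree_lcp mg mh a a'; rewrite -{1}[u]cats0 lcp_cat cats0.
    by move/agree_functional; apply.
  have /prefixP[w ew] := lcp_prefixr v v'; exists w.
  by apply: (agree_cancel a); rewrite -{1}e -ew.
- by move=> u u' [v a] [v' a']; exists (lcp v v'); apply: agree_lcp.
Qed.

Lemma derived_block a : derived_l a != [::] -> block g h (derived_l a) (derived_r a).
Proof.
move=> na; have [[v av] ha min] := baseP na.
have avr : agree g h (derived_l a) (derived_r a).
  by rewrite /derived_r (negPf na); apply: (@xgetI _ [::] _ v).
split=> // u0 v0 pu _ a0 nu0.
have eu : u0 = derived_l a.
  apply: prefix_size_eq => //; apply: min; first by exists v0.
  by rewrite (prefix_ohead pu nu0).
by split=> //; apply: agree_functional avr; rewrite -eu.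
Qed.

Lemma derived_agree a : agree g h (derived_l a) (derived_r a).
Proof.
have [z|/derived_block[]//] := eqVneq (derived_l a) [::].
by rewrite /derived_r z eqxx.
Qed.

Lemma derived_r_eq0 a : (derived_r a == [::]) = (derived_l a == [::]).
Proof. by rewrite (agree_eq0 (derived_agree a)). Qed.

Lemma defined_on_derived w : defined_on derived_r w = defined_on derived_l w.
Proof. by apply: eq_all => a; rewrite derived_r_eq0. Qed.

Lemma marked_derived_l : marked derived_l.
Proof. exact: marked_base. Qed.

(** The first letter of the second component determines the first letter of the
common image, hence that of the first component. *)
Lemma marked_derived_r : marked derived_r.
Proof.
move=> a b na e.
have nb : derived_r b != [::] by move: e na; case: (derived_r b) => //;
  case: (derived_r a).
have [oa oa' ea] := derived_agree a; have [ob ob' eb] := derived_agree b.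
have := na; rewrite derived_r_eq0 => /base_ohead; rewrite -/(derived_l _) => ha.
have := nb; rewrite derived_r_eq0 => /base_ohead; rewrite -/(derived_l _) => hb.
case ua: (derived_l a) oa ea ha => [|a' u] //= /andP[ga _] ea [a'E].
case ub: (derived_l b) ob eb hb => [|b' u'] //= /andP[gb _] eb [b'E].
case va: (derived_r a) na oa' ea e => [|c v] //= _ /andP[hc _] ea.
case vb: (derived_r b) nb ob' eb => [|c' v'] //= _ /andP[hc' _] eb [cE].
rewrite -a'E -b'E; apply: mg => //.
by rewrite -(ohead_ext u ga) -(ohead_ext u' gb) ea eb cE !ohead_ext // -cE.
Qed.

Lemma derived_agree_ext w :
  defined_on derived_l w -> agree g h (ext derived_l w) (ext derived_r w).
Proof.
elim: w => //= a w IH /andP[_ ow]; rewrite !ext_cons.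
exact: agree_cat (derived_agree a) (IH ow).
Qed.

Lemma derived_ascend w :
  solution (derived_l, derived_r) w -> solution (g, h) (ext derived_l w).
Proof. by move=> [ow _ /= e]; rewrite /solution {2}e; apply: derived_agree_ext. Qed.

(** A solution [w] gives the pair [(w, w)] of the pullback; its factorisation into
minimal pairs is a word with the same image [w] under both derived substitutions. *)
Lemma derived_descend w : solution (g, h) w ->
  exists2 w', solution (derived_l, derived_r) w' & ext derived_l w' = w.
Proof.
move=> aw; have [|w' ow' ew'] := base_decompose pullback_submonoid (w := w).
  by exists w.
exists w' => //; split; rewrite /= ?defined_on_derived // -/derived_l ew'.
by apply: agree_functional aw _; rewrite -[X in agree _ _ X _]ew';
  apply: derived_agree_ext.
Qed.

End Derived.

Definition derived (A : choiceType) (B : eqType)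
    (gh : (A -> seq B) * (A -> seq B)) : (A -> seq A) * (A -> seq A) :=
  (derived_l gh.1 gh.2, derived_r gh.1 gh.2).

(** * Bounding the shortest solution of a pair *)

Section Lengths.
Variables (A : choiceType) (B : eqType) (gh : (A -> seq B) * (A -> seq B)).
Hypotheses (mg : marked gh.1) (mh : marked gh.2).

Definition shortest_length (D : eqType) (gh : (A -> seq D) * (A -> seq D)) x : nat :=
  size (base (solution gh) x).

Lemma ext_size_letter (D : eqType) (f : A -> seq D) x w :
  defined_on f (x :: w) -> size (ext f (x :: w)) = size (x :: w) ->
  exists c, f x = [:: c].
Proof.
move=> /andP[nx ow]; rewrite ext_cons size_cat /= => e.
case: (f x) nx e => //= c t _; rewrite addSn => -[] e; exists c; congr (_ :: _).
apply: size0nil; apply/eqP; rewrite -leqn0 -(leq_add2r (size w)) add0n -{2}e.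
by rewrite leq_add2l size_ext.
Qed.

(** A shortest solution [w] factors as the image of a solution [w'] of the derived
pair.  If [w'] is as long as [w], every letter of [w'] has an image of length 1 on
both sides; for the first letter [x] these two images are [x] itself. *)
Lemma shortest_length_derived x : base (solution gh) x != [::] ->
  base (solution (derived gh)) x != [::] /\
  (shortest_length (derived gh) x < shortest_length gh x \/ solution (derived gh) [:: x]).
Proof.
move=> nx; have [aw hw min] := baseP nx.
have [w' aw' ew'] := derived_descend mg mh aw.
have hw' : ohead w' = Some x.
  move: hw; rewrite -ew'; case: w' aw' {ew'} => // c w' [/= /andP[nc _] _ _].
  by rewrite ohead_ext // base_ohead.
have nx' := base_neq0 aw' hw'; split=> //.
have [_ _ /(_ _ aw' hw') le] := baseP nx'; have [ol or e] := aw'.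
have lew : size w' <= size (base (solution gh) x) by rewrite -ew' size_ext.
have [lt|ge] := ltnP (shortest_length (derived gh) x) (shortest_length gh x);
  [by left | right].
have ew : size (ext (derived gh).1 w') = size w'.
  by rewrite [in LHS]/= ew'; apply/eqP; rewrite eqn_leq lew andbT (leq_trans ge).
have [t et] : exists t, w' = x :: t by case: (w') hw' => // c t [->]; exists t.
rewrite {}et in ol or e ew.
have [c /= lx] := ext_size_letter ol ew.
have [d /= rx] := ext_size_letter or (etrans (congr1 size (esym e)) ew).
(* Blocks begin with the letter that indexes them. *)
have ec : c = x.
  by move: ol => /= /andP[/base_ohead + _]; rewrite -/(derived_l _ _ _) lx => -[].
have ed : d = x.
  by move: (congr1 ohead e); rewrite !ext_cons /= lx rx ec => -[].
rewrite /solution; split; rewrite ?ext_cons /=; try by rewrite /= ?lx ?rx.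
by rewrite /= lx rx ec ed.
Qed.

End Lengths.

Section Bound.
Variable A : finType.
Local Notation instance := ((A -> seq A) * (A -> seq A))%type.

Definition complexity_le (B : eqType) (gh : (A -> seq B) * (A -> seq B)) n : Prop :=
  [/\ marked gh.1, marked gh.2,
      exists2 S, size S <= n & has_suffixes S gh.1 &
      exists2 S, size S <= n & has_suffixes S gh.2].

Lemma complexity_derived (B : eqType) (gh : (A -> seq B) * (A -> seq B)) n :
  complexity_le gh n -> complexity_le (derived gh) n.
Proof.
move=> [mg mh [S1 s1 h1] [S2 s2 h2]]; split.
- exact: marked_derived_l.
- exact: marked_derived_r.
- have [S' eS hS] := block_suffixes mh mg h2.
  exists S'; first by rewrite eS.
  move=> a s t ea ns nt; have na : (derived gh).1 a != [::] by rewrite ea; case: (s) ns.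
  by apply: hS ea ns nt; apply/block_sym/derived_block.
- have [S' eS hS] := block_suffixes mg mh h1.
  exists S'; first by rewrite eS.
  move=> a s t ea ns nt; have na : (derived gh).2 a != [::] by rewrite ea; case: (s) ns.
  by apply: hS ea ns nt; apply: derived_block; rewrite // -(derived_r_eq0 _ mh).
Qed.

(** The proper nonempty suffixes of one word have different lengths. *)
Lemma size_suffixes (B : eqType) (g : A -> seq B) S a :
  has_suffixes S g -> size (g a) <= (size S).+1.
Proof.
move=> hS; set w := g a; pose T := [seq drop k w | k <- iota 1 (size w).-1].
have uT : uniq T.
  rewrite map_inj_in_uniq ?iota_uniq // => i j; rewrite !mem_iota => ri rj.
  by move=> /(congr1 size); rewrite !size_drop; lia.
suff : size T <= size S by rewrite size_map size_iota; lia.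
apply: (uniq_leq_size uT) => t /mapP[k]; rewrite mem_iota => rk ->.
apply: (hS a (take k w)); first by rewrite cat_take_drop.
  by rewrite -size_eq0 size_take; case: ifP; lia.
by rewrite -size_eq0 size_drop; lia.
Qed.

(** The finitely many values that determine a pair whose words have at most [n]
letters. *)
Definition instance_code n (I : instance) : {ffun A * bool * 'I_n -> option A} :=
  [ffun t : A * bool * 'I_n => onth ((if t.1.2 then I.1 else I.2) t.1.1) t.2].

Lemma instance_code_inj n (I J : instance) :
  (forall a, size (I.1 a) <= n) -> (forall a, size (I.2 a) <= n) ->
  (forall a, size (J.1 a) <= n) -> (forall a, size (J.2 a) <= n) ->
  instance_code n I = instance_code n J -> I = J.
Proof.
case: I J => [g h] [g' h'] /= bg bh bg' bh' /ffunP e.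
congr (_, _); apply/funext => a; apply: eq_from_onth_le => i.
  move=> lt; have ltn : i < n by apply: leq_trans lt _; rewrite geq_max bg bg'.
  by have := e ((a, true), Ordinal ltn); rewrite !ffunE.
move=> lt; have ltn : i < n by apply: leq_trans lt _; rewrite geq_max bh bh'.
by have := e ((a, false), Ordinal ltn); rewrite !ffunE.
Qed.

(** The number of codes of pairs over [N] letters with words of length at most [n]. *)
Definition depth N n : nat := N.+1 ^ (N * 2 * n).

Variables (I : instance) (n : nat).
Hypothesis cI : complexity_le I n.

Local Notation level i := (iter i (@derived A A) I).

Lemma complexity_level i : complexity_le (level i) n.
Proof. by elim: i => //= i; apply: complexity_derived. Qed.

Lemma size_level i a :
  size ((level i).1 a) <= n.+1 /\ size ((level i).2 a) <= n.+1.
Proof.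
have [_ _ [S1 s1 h1] [S2 s2 h2]] := complexity_level i.
by split; [apply: leq_trans (size_suffixes a h1) _
          |apply: leq_trans (size_suffixes a h2) _].
Qed.

(** The length of the shortest solution decreases strictly until [x] is a solution,
and so all pairs up to that level are different. *)
Lemma letter_level x : base (solution I) x != [::] ->
  exists2 i, i <= depth #|A| n.+1 & solution (level i) [:: x].
Proof.
move=> nx; case: (pselect (exists2 i, i <= depth #|A| n.+1 & solution (level i) [:: x])) => //.
move=> none; set K := depth _ _ in none.
have nxi i : base (solution (level i)) x != [::].
  elim: i => //= i IH; have [mg mh _ _] := complexity_level i.
  by have [] := shortest_length_derived mg mh IH.
have decr i : i < K -> shortest_length (level i.+1) x < shortest_length (level i) x.
  move=> lt; have [mg mh _ _] := complexity_level i.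
  by have [_ [//|a1]] := shortest_length_derived mg mh (nxi i); case: none; exists i.+1.
have decr2 i j : i < j -> j <= K -> shortest_length (level j) x < shortest_length (level i) x.
  elim: j => // j IH; rewrite ltnS leq_eqVlt => /orP[/eqP->|lt] ltK.
    exact: decr.
  by apply: ltn_trans (decr _ ltK) _; apply: IH lt (ltnW ltK).
(* Otherwise the first [K.+1] levels would have different codes, but there are
only [K] codes. *)
pose c (i : 'I_K.+1) := instance_code n.+1 (level i).
have inj_c : injective c.
  move=> i j e; have E : level i = level j.
    by apply: (instance_code_inj (n := n.+1)) e => a;
      have [? ?] := size_level i a; have [? ?] := size_level j a.
  apply/val_inj/eqP; case: ltngtP => // lt.
    by have := decr2 _ _ lt (ltn_ord j); rewrite E ltnn.
  by have := decr2 _ _ lt (ltn_ord i); rewrite E ltnn.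
have := leq_card c inj_c; rewrite card_ord card_ffun card_option !card_prod.
by rewrite card_bool card_ord ltnn.
Qed.

Lemma ascend_level i x w : solution (level i) w -> ohead w = Some x ->
  exists w', [/\ solution I w', ohead w' = Some x & size w' <= size w * n.+1 ^ i].
Proof.
elim: i w => [|i IH] w aw hw; first by exists w; rewrite muln1.
have [mg mh _ _] := complexity_level i.
have [|w' [aw' hw' sw']] := IH _ (derived_ascend mh aw).
  case: w aw hw => // c w [/= /andP[nc _] _ _] [<-].
  by rewrite ohead_ext // base_ohead.
exists w'; split=> //; apply: leq_trans sw' _.
rewrite expnS mulnA leq_mul2r; apply/orP; right; apply: size_ext_le => a.
by have [] := size_level i.+1 a.
Qed.

Lemma bound_level x : base (solution I) x != [::] ->
  exists w, [/\ solution I w, ohead w = Some x &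
                size w <= n.+1 ^ depth #|A| n.+1].
Proof.
move=> /letter_level[i le /(@ascend_level _ x)[//|w [aw hw sw]]].
exists w; split=> //; apply: leq_trans sw _.
by rewrite mul1n leq_pexp2l.
Qed.

End Bound.

(** With [N] letters and images of length at most [L] there are at most [N * L] proper
suffixes, hence derived images of length at most [(N * L).+1].  One derivation
leads to a pair of substitutions on a single alphabet, and the others number at
most [depth]. *)
Definition pair_bound N L : nat :=
  (N * L).+1 ^ (depth N (N * L).+1).+1.

Theorem pair_solution_bound (A : finType) (B : eqType) (g h : A -> seq B) L x v :
  marked g -> marked h -> (forall a, size (g a) <= L) ->
  (forall a, size (h a) <= L) -> solution (g, h) v -> ohead v = Some x ->
  exists w, [/\ solution (g, h) w, ohead w = Some x & size w <= pair_bound #|A| L].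
Proof.
move=> mg mh bg bh av hv; set n := #|A| * L.
have suf f : (forall a, size (f a) <= L) -> exists2 S, size S <= n & has_suffixes S (f : A -> seq B).
  move=> bf; exists [seq drop k (f a) | a <- enum A, k <- iota 0 L].
    by rewrite size_allpairs size_iota -cardE.
  move=> a s t ea ns nt; apply/allpairsP; exists (a, size s); split=> /=.
  - by rewrite mem_enum.
  - rewrite mem_iota /= add0n; apply: leq_trans (bf a); rewrite ea size_cat.
    by rewrite -{1}[size s]addn0 ltn_add2l lt0n size_eq0.
  - by rewrite ea drop_size_cat.
have c0 : complexity_le (g, h) n by split=> //; apply: suf.
have c1 := complexity_derived c0.
have [nx _] := shortest_length_derived (gh := (g, h)) mg mh (base_neq0 av hv).
have [w [aw hw sw]] := bound_level c1 nx.
exists (ext (derived_l g h) w); split; first exact: (derived_ascend mh).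
  case: w aw hw {sw} => // c w [/= /andP[nc _] _ _] [<-].
  by rewrite ohead_ext // base_ohead.
have [_ _ [S sS hS] _] := c1.
apply: (@leq_trans (size w * n.+1)).
  by apply: size_ext_le => a; apply: leq_trans (size_suffixes a hS) _.
by rewrite /pair_bound expnSr leq_mul2r sw orbT.
Qed.

(** * Bounding the shortest solution of a finite family *)

Section Agreeing.
Variables (A : choiceType) (B : eqType).
Implicit Types (P : set (A -> seq B)) (f g : A -> seq B).

(** The condition on the words [f x] that makes a morphism an immersion. *)
Definition immersive f : Prop := marked f /\ forall a, f a != [::].

Definition agreeing P w : Prop := forall f g, P f -> P g -> ext f w = ext g w.

Lemma defined_on_immersive f w : immersive f -> defined_on f w.
Proof. by move=> [_ nf]; apply/allP => a _; apply: nf. Qed.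

Lemma agreeing_submonoid P :
  (forall f, P f -> immersive f) -> lcp_submonoid (agreeing P).
Proof.
move=> iP; split.
- by [].
- by move=> u v eu ev f g Pf Pg; rewrite !ext_cat (eu f g) // (ev f g).
- move=> u v eu euv f g Pf Pg; have := euv f g Pf Pg.
  by rewrite !ext_cat (eu f g) // => /eqP; rewrite eqseq_cat // eqxx => /eqP.
- move=> u v eu ev f g Pf Pg; rewrite !ext_lcp; try exact/defined_on_immersive/iP.
  + by rewrite (eu f g) // (ev f g).
  + by case: (iP _ Pg).
  + by case: (iP _ Pf).
Qed.

End Agreeing.

Lemma ext_comp (A B C : eqType) (f : B -> seq C) (g : A -> seq B) w :
  ext f (ext g w) = ext (ext f \o g) w.
Proof. by elim: w => //= a w IH; rewrite !ext_cons ext_cat IH. Qed.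

Section FamilyBound.
Variables (A : finType) (B : eqType) (L : nat).
Implicit Types (f g : A -> seq B) (s : seq (A -> seq B)).

(** [b] bounds the generators for the members treated so far.  Substituting them in
the next member gives images of length at most [b * L], and substituting them in
a solution multiplies its length by at most [b]. *)
Definition family_bound N k : nat :=
  iter k (fun b => b * pair_bound N (b * L)) 1.

Lemma family_bound_gt0 N k : 0 < family_bound N k.
Proof. by elim: k => //= k IH; rewrite muln_gt0 IH /pair_bound expn_gt0. Qed.

Lemma marked_comp_base f E : marked f -> (forall a, f a != [::]) ->
  marked (ext f \o base E).
Proof.
move=> mf nf a b /=; case ea: (base E a) => [|c u] // _.
case eb: (base E b) => [|d v]; rewrite ohead_ext //.
  by case: (f c) (nf c).
rewrite ohead_ext // => /mf cd; have := cd (nf c) => {}cd.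
have := @base_ohead _ E a; rewrite ea => /(_ isT) [<-].
by have := @base_ohead _ E b; rewrite eb => /(_ isT) [<-].
Qed.

(** For [f :: s] with [s] nonempty, a word is a solution iff it is the image, under
the generators of the solutions for [s], of a solution of the pair that is formed
by [f] and one member of [s] after substitution of these generators. *)
Lemma family_solution_bound s x v :
  (forall f, List.In f s -> immersive f) ->
  (forall f, List.In f s -> forall a, size (f a) <= L) ->
  agreeing (fun f => List.In f s) v -> ohead v = Some x ->
  exists w, [/\ agreeing (fun f => List.In f s) w, ohead w = Some x &
                size w <= family_bound #|A| (size s)].
Proof.
elim: s x v => [|f s IH] x v im bs ev hv; first by exists [:: x]; split=> // f g [].
case: s => [|f0 s] in IH im bs ev *.
  exists [:: x]; split=> //; last exact: family_bound_gt0.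
  by move=> g h /= [<-|//] [<-|//].
set s' := f0 :: s in IH im bs ev *; pose E := agreeing (fun f => List.In f s').
have im' h : List.In h s' -> immersive h by move=> i; apply: im; right.
have bs' h : List.In h s' -> forall a, size (h a) <= L.
  by move=> i; apply: bs; right.
have subE : lcp_submonoid E := agreeing_submonoid im'.
set b := family_bound #|A| (size s').
have base_b a : size (base E a) <= b.
  have [->//|na] := eqVneq (base E a) [::].
  have [Ea ha min] := baseP na.
  have [w [Ew hw sw]] := IH _ _ im' bs' Ea ha.
  exact: leq_trans (min _ Ew hw) sw.
have E_cons w : agreeing (fun h => List.In h (f :: s')) w <->
    E w /\ ext f w = ext f0 w.
  split=> [e|[e e']].
    by split; [move=> g h ig ih; apply: e; right | apply: e; [left|right; left]].
  have e0 g : List.In g s' -> ext g w = ext f0 w by move=> ig; apply: e => //; left.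
  have e1 g : List.In g (f :: s') -> ext g w = ext f0 w.
    by case=> [<-|/e0].
  by move=> g h ig ih; rewrite (e1 _ ig) (e1 _ ih).
have [mf nf] : immersive f by apply: im; left.
have [mf0 nf0] : immersive f0 by apply: im'; left.
have [Ev efv] := (E_cons v).1 ev.
have [v' ov' ev'] := base_decompose subE Ev.
(* The two substitutions left to equalise once the members of [s'] agree. *)
pose g := ext f \o base E; pose g0 := ext f0 \o base E.
have def h : (forall a, h a != [::]) ->
    forall u : seq A, defined_on (ext h \o base E) u = defined_on (base E) u.
  move=> nh u; apply: eq_all => a /=; case: (base E a) => //= c t.
  by rewrite ext_cons; case: (h c) (nh c).
have hd u y : defined_on (base E) u -> ohead (ext (base E) u) = Some y ->
    ohead u = Some y.
  by case: u => //= c u /andP[nc _]; rewrite ohead_ext // base_ohead.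
have bnd h : List.In h (f :: s') -> forall a, size ((ext h \o base E) a) <= b * L.
  move=> ih a; apply: leq_trans (size_ext_le _ (bs _ ih)) _.
  by rewrite leq_mul2r base_b orbT.
have av' : solution (g, g0) v'.
  by split; rewrite /= ?def // -!ext_comp ev'.
have hv' : ohead v' = Some x by apply: hd => //; rewrite ev'.
have [||||w [aw hw sw]] :=
    pair_solution_bound (L := b * L) _ _ _ _ av' hv'.
- exact: marked_comp_base.
- exact: marked_comp_base.
- by apply: bnd; left.
- by apply: bnd; right; left.
have [ow _ ew] := aw; rewrite /= def // in ow.
exists (ext (base E) w); split.
- by apply/E_cons; split; [apply: base_compose | rewrite !ext_comp].
- by case: w hw ow {aw sw ew} => // c w [->] /= /andP[nc _];
  rewrite ohead_ext // base_ohead.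
- apply: leq_trans (size_ext_le w base_b) _.
  by rewrite mulnC /= leq_mul2l sw orbT.
Qed.

End FamilyBound.

(** * Free groups: immersions act without cancellation *)

Section Words.
Variable A : choiceType.
Implicit Types (u v w : seq (letter A)).

Lemma word_inv_cat u v : word_inv (u ++ v) = word_inv v ++ word_inv u.
Proof. by rewrite /word_inv map_cat rev_cat. Qed.

Lemma word_invK : involutive (@word_inv A).
Proof.
move=> w; rewrite /word_inv map_rev revK -map_comp.
by rewrite (eq_map (@letter_invK A)) map_id.
Qed.

Lemma word_inv_eq0 w : (word_inv w == [::]) = (w == [::]).
Proof. by rewrite -!size_eq0 /word_inv size_rev size_map. Qed.

Lemma letter_inv_neq (x : letter A) : letter_inv x != x.
Proof. by case: x => a []; apply/eqP; case. Qed.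

Lemma reduced_catl u v : reduced (u ++ v) -> reduced u.
Proof. by rewrite /reduced; case: u => //= x u; rewrite cat_path => /andP[]. Qed.

Lemma reduced_catr u v : reduced (u ++ v) -> reduced v.
Proof.
rewrite /reduced; case: u => //= x u; rewrite cat_path => /andP[_].
exact: path_sorted.
Qed.

Lemma reduced_prefix u v : prefix u v -> reduced v -> reduced u.
Proof. by case/prefixP => s ->; apply: reduced_catl. Qed.

Lemma reduced_cat u v : reduced u -> reduced v ->
  ohead (word_inv u) <> ohead v -> reduced (u ++ v).
Proof.
case: u => //= x u ru rv; rewrite /reduced /= cat_path.
rewrite lastI /word_inv map_rcons rev_rcons /=.
case: v rv => [|y v] rv ne; rewrite [path _ x u]ru //= -/(reduced _).
move: rv; rewrite /reduced /= => ->; rewrite andbT.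
by apply/eqP => e; apply: ne; rewrite e.
Qed.

Lemma reduce_catr u v : reduce (u ++ reduce v) = reduce (u ++ v).
Proof. by rewrite reduce_cat ?reduce_reduced // /reduce foldr_cat. Qed.

Lemma reduce_catl u v : reduce (reduce u ++ v) = reduce (u ++ v).
Proof.
rewrite -reduce_catr -[RHS]reduce_catr !reduce_cat ?reduce_reduced //.
by rewrite {2}/reduce foldr_foldr ?reduce_reduced.
Qed.

Lemma reduce_cancel u v : reduce (u ++ word_inv u ++ v) = reduce v.
Proof.
elim: u v => //= x u IH v; rewrite -[x :: u]cat1s word_inv_cat -catA IH /=.
by rewrite cons_reduceK // reduce_reduced.
Qed.

(** The two ends of such a word are inverse letters.  Removing them leads to a
pair of cancelling letters, or to a letter that is its own inverse, in the middle. *)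
Lemma word_inv_neq w : reduced w -> word_inv w = w -> w = [::].
Proof.
move: {2}(size w) (leqnn (size w)) => n; elim: n w => [|n IH] w.
  by rewrite leqn0 => /nilP.
case: w => // x w; case/lastP: w => [|w y] le rw.
  by move=> /= [/eqP]; rewrite (negPf (letter_inv_neq x)).
rewrite -cats1 -cat1s !word_inv_cat /= -[_ :: _]/([:: _] ++ _).
move=> e; have ey : y = letter_inv x.
  move: e => /(congr1 (last x)); rewrite !cat1s /= !last_cat /=.
  by move=> ->.
have ew : word_inv w = w.
  by case: e => _ /eqP; rewrite eqseq_cat ?size_rev ?size_map // => /andP[/eqP].
have w0 : w = [::].
  apply: IH ew; first by move: le; rewrite /= size_rcons ltnS; apply: ltnW.
  by move: rw; rewrite -cats1 -cat1s => /reduced_catr/reduced_catl.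
by move: rw; rewrite w0 /reduced /= ey eqxx.
Qed.

End Words.

Section Equivariant.
Variables A B : choiceType.
Implicit Types (f : letter A -> seq (letter B)) (w : seq (letter A)).

(** The maps on letters that extend to a morphism of free groups with the same values
on the generators and their inverses. *)
Definition equivariant f : Prop :=
  (forall x, f (letter_inv x) = word_inv (f x)) /\ forall x, reduced (f x).

Lemma ext_word_inv f w : equivariant f ->
  ext f (word_inv w) = word_inv (ext f w).
Proof.
move=> [ef _]; elim: w => //= x w IH.
by rewrite -cat1s word_inv_cat ext_cat IH !ext_cons cats0 ef word_inv_cat.
Qed.

(** A cancellation between [f x] and [f y] would mean that [f x^-1] and [f y] begin
with the same letter, hence that [y] is [x^-1]. *)
Lemma reduced_ext f w : equivariant f -> immersive f ->
  reduced w -> reduced (ext f w).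
Proof.
move=> [ef rf] [mf nf]; elim: w => //= x w IH rw; rewrite ext_cons.
apply: reduced_cat => //; first by apply: IH; apply: path_sorted rw.
rewrite -ef; case: w rw {IH} => [|y w] /=.
  by move=> _; case: (f _) (nf (letter_inv x)).
move=> /andP[ne _]; rewrite ohead_ext // => /mf e.
by rewrite -e ?eqxx ?nf // in ne.
Qed.

Lemma reduce_ext_reduce f w : equivariant f ->
  reduce (ext f (reduce w)) = reduce (ext f w).
Proof.
move=> [ef rf]; elim: w => //= x w IH; rewrite ext_cons -reduce_catr -IH reduce_catr.
case: (reduce w) => [|y t] //=; case: eqP => //= ->.
by rewrite !ext_cons ef reduce_cancel.
Qed.

Section Morphism.
Variables (f : letter A -> seq (letter B)) (ef : equivariant f).

Definition fg_extend (w : free_group A) : free_group B :=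
  FreeGroup (reduce_reduced (ext f w)).

Lemma fg_extend_mul : {morph fg_extend : u v / (u * v)%g}.
Proof.
move=> u v; apply: val_inj => /=; rewrite reduce_ext_reduce // ext_cat.
by rewrite reduce_catl reduce_catr.
Qed.

HB.instance Definition _ :=
  isMultiplicative.Build (free_group A) (free_group B) fg_extend fg_extend_mul.

Definition fg_extension : {multiplicative free_group A -> free_group B} := fg_extend.

Lemma fg_extension_letter x : fg_word (fg_extension (fg_letter x)) = f x.
Proof. by case: ef => _ rf; rewrite /= ext_cons cats0 reduceE. Qed.

End Morphism.

End Equivariant.

Section Immersion.
Variables Sigma Delta : finType.
Implicit Types f : {multiplicative free_group Sigma -> free_group Delta}.

Definition letter_word f (x : letter Sigma) : seq (letter Delta) :=
  fg_word (f (fg_letter x)).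

Lemma morph_one f : f 1%g = 1%g.
Proof. by apply: (mulgI (f 1%g)); rewrite -gmulfM !mulg1. Qed.

Lemma morph_inv f w : f (w^-1)%g = (f w)^-1%g.
Proof. by apply: (mulgI (f w)); rewrite -gmulfM !mulgV morph_one. Qed.

Lemma letter_word_equivariant f : equivariant (letter_word f).
Proof.
split=> x; last exact: fg_wordP.
have e : fg_letter (letter_inv x) = (fg_letter x)^-1%g by apply: val_inj.
by rewrite /letter_word e morph_inv.
Qed.

Lemma immersion_immersive f : immersion f -> immersive (letter_word f).
Proof.
move=> [nf mf]; split=> [x y _ e|x]; last by apply/eqP/nf.
by apply: contrapT => ne; apply: mf ne e.
Qed.

Lemma immersive_immersion f : immersive (letter_word f) -> immersion f.
Proof.
move=> [mf nf]; split=> [x|x y ne e]; first exact/eqP/nf.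
by apply: ne; apply: mf (nf x) e.
Qed.

Lemma immersion_word f w : immersion f -> fg_word (f w) = ext (letter_word f) w.
Proof.
move=> imf; case: w => w rw /=; elim: w rw => [|x w IH] rw.
  have -> : FreeGroup rw = 1%g by apply: val_inj.
  by rewrite morph_one.
have rw' : reduced w by apply: path_sorted rw.
have -> : FreeGroup rw = (fg_letter x * FreeGroup rw')%g.
  by apply: val_inj; apply: esym (reduceE rw).
rewrite gmulfM /= IH -/(letter_word f x) -ext_cons reduceE //.
apply: reduced_ext => //; first exact: letter_word_equivariant.
exact: immersion_immersive.
Qed.

Lemma set_equaliserP (S : set {multiplicative free_group Sigma -> free_group Delta}) w :
  (forall f, S f -> immersion f) ->
  set_equaliser S w <-> agreeing (letter_word @` S)%classic (fg_word w).
Proof.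
move=> iS; split=> [e _ _ [f Sf <-] [g Sg <-]|e f Sf g Sg].
  by rewrite -(immersion_word _ (iS f Sf)) -(immersion_word _ (iS g Sg)) (e f Sf g Sg).
apply: val_inj; rewrite /= !immersion_word; try exact: iS.
by apply: e; [exists f | exists g].
Qed.

End Immersion.

(** * A basis from the primitive words *)

Section Selection.
Variable T : choiceType.
Implicit Types (u w : seq (letter T)) (ws acc : seq (seq (letter T))).

Definition end_heads acc : seq (option (letter T)) :=
  flatten [seq [:: ohead u; ohead (word_inv u)] | u <- acc].

(** A greedy choice of one word out of each pair [w], [w^-1]: a word that is already
represented, itself or by its inverse, is recognised by its first letter. *)
Definition select (b : pred (seq (letter T))) ws : seq (seq (letter T)) :=
  foldl (fun acc w => if b w && (ohead w \notin end_heads acc) then w :: acc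
                      else acc) [::] ws.

End Selection.

(** The image of the letter [(a, b)] when [a] is sent to [u]. *)
Definition orient (T : choiceType) (b : bool) (u : seq (letter T)) :=
  if b then word_inv u else u.

Section Basis.
Variables (A : finType) (E : seq (letter A) -> Prop).
Implicit Types (u v w p : seq (letter A)) (acc : seq (seq (letter A))).
Hypothesis subE : lcp_submonoid E.
Hypothesis invE : forall w, E w -> E (word_inv w).

(** Equivalently, a reduced word that is the shortest element of [E] with its first
letter. *)
Definition primitive w : Prop :=
  [/\ reduced w, E w, w != [::] &
      forall p, prefix p w -> p != [::] -> E p -> p = w].

Lemma primitive_prefix u v : primitive u -> E v -> ohead u = ohead v -> prefix u v.
Proof.
move=> [_ Eu nu min] Ev e; have <- : lcp u v = u; last exact: lcp_prefixr.
apply: min; first exact: lcp_prefixl; last exact: lcp_submonoidI.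
by case: (lcp u v) (ohead_lcp e) => //; case: (u) nu.
Qed.

Lemma primitive_eq u v : primitive u -> primitive v -> ohead u = ohead v -> u = v.
Proof.
move=> bu bv e; have [_ Eu nu _] := bu; have [_ Ev _ min] := bv.
by apply: min => //; apply: primitive_prefix.
Qed.

(** A factorisation of [u^-1] in [E] inverts to a factorisation of [u]. *)
Lemma primitive_inv u : primitive u -> primitive (word_inv u).
Proof.
move=> [ru Eu nu min]; split.
- exact: word_inv_reduced.
- exact: invE.
- by rewrite word_inv_eq0.
move=> p /prefixP[s es] np Ep.
have eu : u = word_inv s ++ word_inv p by rewrite -word_inv_cat -es word_invK.
have Es : E s by apply: lcp_submonoidK Ep _; rewrite // -es; apply: invE.
have [s0|ns] := eqVneq s [::]; first by rewrite es s0 cats0.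
have : word_inv s = u.
  apply: min; last exact: invE; first by rewrite eu prefix_prefix.
  by rewrite word_inv_eq0.
rewrite eu -[LHS]cats0 => /eqP; rewrite eqseq_cat // eqxx => /eqP/esym/eqP.
by rewrite word_inv_eq0 (negPf np).
Qed.

Lemma primitive_orient b u : primitive u -> primitive (orient b u).
Proof. by case: b => //; apply: primitive_inv. Qed.

Lemma primitive_ex x w : E (x :: w) -> reduced (x :: w) ->
  primitive (base E x) /\ ohead (base E x) = Some x.
Proof.
move=> Ew rw; have hw : ohead (x :: w) = Some x by [].
have nb := base_neq0 Ew hw; have [Eb hb min] := baseP nb; split=> //; split=> //.
  exact: reduced_prefix (base_prefix subE Ew hw) rw.
move=> p pp np Ep; apply: prefix_size_eq => //; apply: min => //.
by rewrite (prefix_ohead pp np).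
Qed.

Lemma size_primitive x u v : primitive u -> ohead u = Some x ->
  E v -> ohead v = Some x -> size u <= size v.
Proof. by move=> bu hu Ev hv; apply: size_prefix; apply: primitive_prefix;
  rewrite ?hu. Qed.

Definition independent (acc : seq (seq (letter A))) : Prop :=
  (forall u, u \in acc -> primitive u) /\
  forall i j b c, i < size acc -> j < size acc ->
    ohead (orient b (nth [::] acc i)) = ohead (orient c (nth [::] acc j)) ->
    i = j /\ b = c.

Lemma mem_end_heads acc u b : u \in acc -> ohead (orient b u) \in end_heads acc.
Proof.
move=> ua; apply/flattenP; exists [:: ohead u; ohead (word_inv u)].
  exact: map_f.
by case: b; rewrite !inE eqxx ?orbT.
Qed.

Lemma end_headsP acc x : x \in end_heads acc ->
  exists i b, i < size acc /\ x = ohead (orient b (nth [::] acc i)).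
Proof.
move=> /flattenP[_ /mapP[u ua ->]]; rewrite !inE -(nth_index [::] ua).
by case/orP=> /eqP ->; exists (index u acc); [exists false|exists true];
  rewrite index_mem.
Qed.

Lemma orientK b c (u w : seq (letter A)) :
  orient b w = orient c u -> w = orient (b (+) c) u.
Proof.
case: b c => [] [] //=; first exact: can_inj (@word_invK _) _ _.
by move=> <-; rewrite word_invK.
Qed.

(** By [primitive_eq] a clash of first letters is an equality of words.  It would
make [w] or [w^-1] one of the earlier words, or [w] its own inverse. *)
Lemma independent_cons w acc : primitive w -> ohead w \notin end_heads acc ->
  independent acc -> independent (w :: acc).
Proof.
move=> bw nw [pa ia]; split.
  by move=> u; rewrite inE => /orP[/eqP->|/pa].
have new b c u : u \in acc -> ohead (orient b w) <> ohead (orient c u).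
  move=> ua e; have := primitive_eq (primitive_orient b bw) (primitive_orient c (pa u ua)) e.
  by move=> /orientK ew; move: nw; rewrite ew mem_end_heads.
have self b c : ohead (orient b w) = ohead (orient c w) -> b = c.
  move=> e; have := primitive_eq (primitive_orient b bw) (primitive_orient c bw) e.
  have [rw _ nnw _] := bw => /orientK;
    case: (b) (c) => [] [] //= /esym/(word_inv_neq rw) w0.
  - by rewrite w0 in nnw.
  - by rewrite w0 in nnw.
move=> [|i] [|j] b c /=; rewrite ?ltnS => li lj e.
- by split=> //; apply: self.
- by case: (new _ _ _ (mem_nth _ lj) e).
- by case: (new _ _ _ (mem_nth _ li) (esym e)).
- by have [-> ->] := ia _ _ _ _ li lj e.
Qed.

Variables (is_prim : pred (seq (letter A))) (ws : seq (seq (letter A))).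
Hypothesis is_primP : forall w, is_prim w <-> primitive w.
Hypothesis wsP : forall w, primitive w -> w \in ws.

Local Notation gens := (select is_prim ws).

Lemma independent_select : independent gens.
Proof.
rewrite /select; set f := (fun acc w => _).
suff gen l acc : independent acc -> independent (foldl f acc l) by apply: gen.
elim: l acc => //= w l IH acc ia; apply: IH; rewrite /f;
  case: ifP => // /andP[/is_primP bw nw].
exact: independent_cons.
Qed.

Lemma select_complete w : primitive w -> ohead w \in end_heads gens.
Proof.
move=> bw; have := wsP bw; rewrite /select; set f := (fun acc w => _).
have mono l acc x : x \in end_heads acc -> x \in end_heads (foldl f acc l).
  elim: l acc => //= v l IH acc xa; apply: IH; rewrite /f; case: ifP => // _.
  by rewrite /end_heads /= !inE xa !orbT.
suff gen l acc : w \in l -> ohead w \in end_heads (foldl f acc l) by apply: gen.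
elim: l acc => //= v l IH acc; rewrite inE => /orP[/eqP <-|]; last exact: IH.
apply: mono; rewrite /f; case: ifPn => [_|].
  by apply: (@mem_end_heads _ _ false); rewrite inE eqxx.
by rewrite negb_and negbK => /orP[/negP[]|//]; apply/is_primP.
Qed.

Definition gen_word (y : letter 'I_(size gens)) : seq (letter A) :=
  orient y.2 (nth [::] gens y.1).

Lemma primitive_gen_word y : primitive (gen_word y).
Proof.
have [pa _] := independent_select.
by apply/primitive_orient/pa/mem_nth/ltn_ord.
Qed.

Lemma gen_word_equivariant : equivariant gen_word.
Proof.
split=> y; last by have [] := primitive_gen_word y.
by rewrite /gen_word /orient /=; case: y.2; rewrite //= word_invK.
Qed.

Lemma gen_word_immersive : immersive gen_word.
Proof.
split=> [y z _ e|y]; last by have [] := primitive_gen_word y.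
have [_ ia] := independent_select.
have [/val_inj e1 e2] := ia _ _ _ _ (ltn_ord y.1) (ltn_ord z.1) e.
by case: y z e1 e2 {e} => ? ? [? ?] /= -> ->.
Qed.

Definition basis_map : {multiplicative free_group 'I_(size gens) -> free_group A} :=
  fg_extension gen_word_equivariant.

Lemma letter_word_basis_map : letter_word basis_map = gen_word.
Proof. by apply/funext => y; apply: fg_extension_letter. Qed.

Lemma basis_map_immersion : immersion basis_map.
Proof. apply: immersive_immersion; rewrite letter_word_basis_map;
  exact: gen_word_immersive. Qed.

(** A reduced word of [E] begins like one of the chosen words or their inverses, and
splitting it off leaves a shorter reduced word of [E]. *)
Lemma basis_map_range : range basis_map = [set w : free_group A | E (fg_word w)]%classic.
Proof.
apply/seteqP; split=> [_ [w _ <-]|w].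
  suff : E (fg_word (basis_map w)) by [].
  rewrite (immersion_word w basis_map_immersion).
  rewrite letter_word_basis_map; elim: (fg_word w) => [|y t IH].
    exact: lcp_submonoid1.
  rewrite ext_cons; apply: lcp_submonoidM => //.
  by have [] := primitive_gen_word y.
have nil_case (rw : reduced [::]) : range basis_map (FreeGroup rw).
  by exists 1%g => //; rewrite morph_one; apply/(@val_inj _ _ (free_group A)).
move: {2}(size w) (leqnn (size w)) => n.
elim: n w => [|n IH] [[|x w] rw] // le Ew; try exact: nil_case.
have [bx hx] := primitive_ex Ew rw.
have /end_headsP[i [b [lti e]]] := select_complete bx.
pose y : letter 'I_(size gens) := (Ordinal lti, b).
have by_ := primitive_gen_word y; have [ry Ey ny _] := by_.
have hy : ohead (gen_word y) = ohead (x :: w) by rewrite -[RHS]hx e.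
have /prefixP[s es] := primitive_prefix by_ Ew hy.
have rs : reduced s by apply: (@reduced_catr _ (gen_word y)); rewrite -es.
have Es : E s by apply: lcp_submonoidK Ey _; rewrite // -es.
have [|//|v _ ev] := IH (FreeGroup rs).
  have {}le : size w < n.+1 := le; change (is_true (size s <= n));
    move: (congr1 size es); rewrite size_cat /=.
  by case: (gen_word y) ny => //= ? ? _ [e2]; rewrite -ltnS; apply: leq_trans le;
    rewrite ltnS e2 leq_addl.
exists (fg_letter y * v)%g => //; rewrite gmulfM ev; apply: val_inj => /=.
have := fg_extension_letter gen_word_equivariant y.
rewrite -/basis_map /= => ->; rewrite -es; exact: reduceE.
Qed.

End Basis.

(** * Computable functions between encoded types *)

Generalizable Variables X T U V.

(** Typed data represented as trees.  The instances agree with the encoding of the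
input and output of the algorithm. *)
Class encodable (T : Type) := encode : T -> tree.

#[global] Instance encodable_unit : encodable unit := fun=> Defs.Nil.
#[global] Instance encodable_nat : encodable nat := encode_nat.
#[global] Instance encodable_bool : encodable bool := encode_bool.
#[global] Instance encodable_prod T U {eT : encodable T} {eU : encodable U} :
  encodable (T * U) := fun x => Defs.Cons (encode x.1) (encode x.2).
#[global] Instance encodable_seq T {eT : encodable T} : encodable (seq T) :=
  fun s => encode_seq (map encode s).
#[global] Instance encodable_option T {eT : encodable T} : encodable (option T) :=
  fun o => encode (oapp (cons^~ [::]) [::] o).

(** All closure properties below are stated for functions of an environment [x : X],
which plays the role of the free variables of a functional program. *)
Definition computable {T U} {eT : encodable T} {eU : encodable U} (f : T -> U) :=
  exists p, forall x, exec p (encode x) (encode (f x)).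

Section Basic.
Context {X T U : Type} {eX : encodable X} {eT : encodable T} {eU : encodable U}.

Lemma computable_ext (f g : X -> T) : f =1 g -> computable f -> computable g.
Proof. by move=> e [p hp]; exists p => x; rewrite -e. Qed.

Lemma computable_id : computable (fun x : X => x).
Proof. by exists PId => x; constructor. Qed.

Lemma computable_comp (f : X -> T) (g : T -> U) :
  computable f -> computable g -> computable (fun x => g (f x)).
Proof.
move=> [p hp] [q hq]; exists (PSeq p q) => x.
by apply: exec_seq; [apply: hp | apply: hq].
Qed.

(** A function may change the type of its values if it preserves their codes. *)
Lemma computable_recode (f : X -> T) (g : X -> U) :
  (forall x, encode (f x) = encode (g x)) -> computable f -> computable g.
Proof. by move=> e [p hp]; exists p => x; rewrite -e. Qed.

Lemma computable_cst (c : T) : computable (fun _ : X => c).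
Proof.
have [p hp] : exists p, forall t, exec p t (encode c).
  elim: (encode c) => [|u [p hp] v [q hq]]; first by exists PNil => t; constructor.
  by exists (PCons p q) => t; constructor.
by exists p.
Qed.

Lemma computable_pair (f : X -> T) (g : X -> U) :
  computable f -> computable g -> computable (fun x => (f x, g x)).
Proof. by move=> [p hp] [q hq]; exists (PCons p q) => x; constructor. Qed.

Lemma computable_fst (f : X -> T * U) : computable f -> computable (fun x => (f x).1).
Proof.
move=> [p hp]; exists (PSeq p PHead) => x; apply: exec_seq (hp x) _.
exact: exec_head.
Qed.

Lemma computable_snd (f : X -> T * U) : computable f -> computable (fun x => (f x).2).
Proof.
move=> [p hp]; exists (PSeq p PTail) => x; apply: exec_seq (hp x) _.
exact: exec_tail.
Qed.

Lemma computable_if (b : X -> bool) (f g : X -> T) :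
  computable b -> computable f -> computable g ->
  computable (fun x => if b x then f x else g x).
Proof.
move=> [p hp] [q hq] [r hr]; exists (PIf p q r) => x; move: (hp x).
by case: (b x) => hb; [apply: exec_if_true hb _ | apply: exec_if_false hb _].
Qed.

Lemma computable_cons (f : X -> T) (s : X -> seq T) :
  computable f -> computable s -> computable (fun x => f x :: s x).
Proof. by move=> [p hp] [q hq]; exists (PCons p q) => x; constructor. Qed.

Lemma computable_behead (s : X -> seq T) :
  computable s -> computable (fun x => behead (s x)).
Proof.
move=> [p hp]; exists (PSeq p PTail) => x; apply: exec_seq (hp x) _.
by case: (s x) => [|a t]; apply: exec_tail.
Qed.

Lemma computable_nilp (s : X -> seq T) :
  computable s -> computable (fun x => nilp (s x)).
Proof.
move=> [p hp]; exists (PIf p PNil (PCons PNil PNil)) => x; move: (hp x).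
case: (s x) => [|a t] hs; first by apply: exec_if_false hs _; do !constructor.
by apply: exec_if_true hs _; constructor.
Qed.

Lemma computable_head d (s : X -> seq T) :
  computable s -> computable (fun x => head d (s x)).
Proof.
move=> cs; have [p hp] := cs; have [q hq] := computable_cst d.
exists (PIf p (PSeq p PHead) q) => x; move: (hp x) (hq x).
case: (s x) => [|a t] hs hd; first by apply: exec_if_false hs _.
by apply: exec_if_true (hs) _; apply: exec_seq hs _; apply: exec_head.
Qed.

(** This is the only lemma that needs a loop.  Its state is the triple of the
environment, the accumulator and the rest of the list. *)
Lemma computable_foldl (f : X -> U -> T -> U) (z : X -> U) (s : X -> seq T) :
  computable (fun y : X * (U * T) => f y.1 y.2.1 y.2.2) ->
  computable z -> computable s -> computable (fun x => foldl (f x) (z x) (s x)).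
Proof.
move=> [p hp] [q hq] [r hr].
pose acc := PSeq PTail PHead; pose rest := PSeq PTail PTail.
pose body := PCons PHead (PCons
  (PSeq (PCons PHead (PCons acc (PSeq rest PHead))) p) (PSeq rest PTail)).
have loop x t a : exec (PWhile rest body) (encode (x, (a, t)))
    (encode (x, (foldl (f x) a t, ([::] : seq T)))).
  elim: t a => [|b t IH] a /=.
    by apply: exec_while_stop; apply: exec_seq; [apply: exec_tail|apply: exec_tail].
  have hrest : exec rest (encode (x, (a, b :: t))) (encode (b :: t)).
    by apply: exec_seq; [apply: exec_tail|apply: exec_tail].
  apply: exec_while_step (IH (f x a b)); first exact: hrest.
  apply: exec_cons; first exact: exec_head.
  apply: exec_cons; last by apply: exec_seq hrest _; apply: exec_tail.
  apply: exec_seq (hp (x, (a, b))); apply: exec_cons; first exact: exec_head.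
  apply: exec_cons; last by apply: exec_seq hrest _; apply: exec_head.
  by apply: exec_seq; [apply: exec_tail | apply: exec_head].
exists (PSeq (PSeq (PCons PId (PCons q r)) (PWhile rest body)) acc) => x.
apply: exec_seq; first apply: exec_seq (loop x (s x) (z x)).
  by apply: exec_cons; [apply: exec_id | apply: exec_cons].
by apply: exec_seq; [apply: exec_tail | apply: exec_head].
Qed.

End Basic.

Lemma computable_uncurry `{encodable X, encodable T, encodable U, encodable V}
    (f : X -> T -> U) :
  computable (fun y : X * T => f y.1 y.2) ->
  forall (g : V -> X) (h : V -> T), computable g -> computable h ->
  computable (fun x => f (g x) (h x)).
Proof.
move=> cf g h cg ch.
exact: (computable_comp (g := fun y => f y.1 y.2) (computable_pair cg ch)).
Qed.

Lemma computable_rev `{encodable X, encodable T} (s : X -> seq T) :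
  computable s -> computable (fun x => rev (s x)).
Proof.
move=> cs; apply: (computable_ext (f := fun x => foldl (fun a b => b :: a) [::] (s x))).
  by move=> x; rewrite -[in LHS](revK (s x)) foldl_rev; elim: (rev _) => //= a t ->.
apply: computable_foldl => //; last exact: computable_cst.
by apply: computable_cons;
  do ![apply: computable_id | apply: computable_snd | apply: computable_fst].
Qed.

Lemma computable_foldr `{encodable X, encodable T, encodable U}
    (f : X -> T -> U -> U) (z : X -> U) (s : X -> seq T) :
  computable (fun y : X * (U * T) => f y.1 y.2.2 y.2.1) ->
  computable z -> computable s -> computable (fun x => foldr (f x) (z x) (s x)).
Proof.
move=> cf cz cs.
apply: (computable_ext (f := fun x => foldl (fun a b => f x b a) (z x) (rev (s x)))).
  by move=> x; rewrite foldl_rev.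
by apply: (computable_foldl (f := fun x a b => f x b a)) => //; apply: computable_rev.
Qed.

Ltac computable_proj :=
  lazymatch goal with
  | |- computable (fun x => x) => exact: computable_id
  | |- computable fst => exact: (computable_fst (f := fun x => x) computable_id)
  | |- computable snd => exact: (computable_snd (f := fun x => x) computable_id)
  | |- computable (fun x => fst (@?g x)) => apply: (computable_fst (f := g));
    computable_proj
  | |- computable (fun x => snd (@?g x)) => apply: (computable_snd (f := g));
    computable_proj
  | |- computable (fun x => ?c) => first [assumption | exact: computable_cst]
  | |- _ => assumption
  end.

Lemma computable_map `{encodable X, encodable T, encodable U}
    (f : X -> T -> U) (s : X -> seq T) :
  computable (fun y : X * T => f y.1 y.2) -> computable s ->
  computable (fun x => map (f x) (s x)).
Proof.
move=> cf cs; apply: (computable_foldr (f := fun x a t => f x a :: t)) => //.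
  apply: computable_cons; last by computable_proj.
  by apply: (computable_uncurry cf); computable_proj.
exact: computable_cst.
Qed.

Lemma computable_cat `{encodable X, encodable T} (s t : X -> seq T) :
  computable s -> computable t -> computable (fun x => s x ++ t x).
Proof.
move=> cs ct; apply: (computable_ext (f := fun x => foldr cons (t x) (s x))).
  by move=> x; elim: (s x) => //= a u ->.
apply: (computable_foldr (f := fun x => cons)) => //.
by apply: computable_cons; computable_proj.
Qed.

Lemma computable_flatten `{encodable X, encodable T} (s : X -> seq (seq T)) :
  computable s -> computable (fun x => flatten (s x)).
Proof.
move=> cs; apply: (computable_foldr (f := fun x => cat)) => //.
  by apply: computable_cat; computable_proj.
exact: computable_cst.
Qed.

Lemma computable_negb `{encodable X} (b : X -> bool) :
  computable b -> computable (fun x => ~~ b x).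
Proof.
move=> cb; apply: (computable_ext (f := fun x => if b x then false else true)) => //.
by apply: computable_if => //; apply: computable_cst.
Qed.

Lemma computable_andb `{encodable X} (b c : X -> bool) :
  computable b -> computable c -> computable (fun x => b x && c x).
Proof.
move=> cb cc; apply: (computable_ext (f := fun x => if b x then c x else false)) => //.
by apply: computable_if => //; apply: computable_cst.
Qed.

Lemma computable_orb `{encodable X} (b c : X -> bool) :
  computable b -> computable c -> computable (fun x => b x || c x).
Proof.
move=> cb cc; apply: (computable_ext (f := fun x => if b x then true else c x)) => //.
by apply: computable_if => //; apply: computable_cst.
Qed.

Lemma computable_all `{encodable X, encodable T} (f : X -> T -> bool) (s : X -> seq T) :
  computable (fun y : X * T => f y.1 y.2) -> computable s ->
  computable (fun x => all (f x) (s x)).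
Proof.
move=> cf cs; apply: (computable_foldr (f := fun x a b => f x a && b)) => //.
  apply: computable_andb; last by computable_proj.
  by apply: (computable_uncurry cf); computable_proj.
exact: computable_cst.
Qed.

(** A number has the same code as a list of as many units, so that iteration is a fold. *)
Lemma computable_iter `{encodable X, encodable U} (n : X -> nat)
    (f : X -> U -> U) (z : X -> U) :
  computable n -> computable (fun y : X * U => f y.1 y.2) -> computable z ->
  computable (fun x => iter (n x) (f x) (z x)).
Proof.
move=> cn cf cz.
apply: (computable_ext (f := fun x => foldr (fun _ => f x) (z x) (nseq (n x) tt))).
  by move=> x; elim: (n x) => //= m ->.
apply: (computable_foldr (f := fun x _ => f x)) => //.
  by apply: (computable_uncurry cf); computable_proj.
apply: computable_recode cn => x; elim: (n x) => // m.
by rewrite /encode /encodable_nat /encode_nat /= => ->.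
Qed.

Lemma computable_succ `{encodable X} (n : X -> nat) :
  computable n -> computable (fun x => (n x).+1).
Proof.
move=> [q hq]; exists (PCons PNil q) => x.
by apply: exec_cons; [apply: exec_nil | apply: hq].
Qed.

Lemma computable_pred `{encodable X} (n : X -> nat) :
  computable n -> computable (fun x => (n x).-1).
Proof.
move=> [p hp]; exists (PSeq p PTail) => x; apply: exec_seq (hp x) _.
by case: (n x) => [|m]; apply: exec_tail.
Qed.

Lemma computable_size `{encodable X, encodable T} (s : X -> seq T) :
  computable s -> computable (fun x => size (s x)).
Proof.
move=> cs; apply: (computable_ext (f := fun x => foldr (fun _ => succn) 0 (s x))) => //.
apply: (computable_foldr (f := fun x _ => succn)) => //; last exact: computable_cst.
by apply: computable_succ; computable_proj.
Qed.

Lemma computable_add `{encodable X} (m n : X -> nat) :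
  computable m -> computable n -> computable (fun x => m x + n x).
Proof.
move=> cm cn; apply: (computable_ext (f := fun x => iter (m x) succn (n x))).
  by move=> x; rewrite iter_succn addnC.
by apply: (computable_iter (f := fun x => succn)) => //; apply: computable_succ;
  computable_proj.
Qed.

Lemma computable_sub `{encodable X} (m n : X -> nat) :
  computable m -> computable n -> computable (fun x => m x - n x).
Proof.
move=> cm cn; apply: (computable_ext (f := fun x => iter (n x) predn (m x))).
  by move=> x; elim: (n x) => [|k IH]; rewrite ?subn0 // subnS -IH.
by apply: (computable_iter (f := fun x => predn)) => //; apply: computable_pred;
  computable_proj.
Qed.

Lemma computable_mul `{encodable X} (m n : X -> nat) :
  computable m -> computable n -> computable (fun x => m x * n x).
Proof.
move=> cm cn; apply: (computable_ext (f := fun x => iter (m x) (addn (n x)) 0)).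
  by move=> x; rewrite iter_addn addn0 mulnC.
apply: (computable_iter (f := fun x => addn (n x))) => //; last exact: computable_cst.
apply: computable_add; last by computable_proj.
by apply: (computable_comp (g := n)); computable_proj.
Qed.

Lemma computable_exp `{encodable X} (m n : X -> nat) :
  computable m -> computable n -> computable (fun x => m x ^ n x).
Proof.
move=> cm cn; apply: (computable_ext (f := fun x => iter (n x) (muln (m x)) 1)).
  by move=> x; rewrite iter_muln muln1.
apply: (computable_iter (f := fun x => muln (m x))) => //; last exact: computable_cst.
apply: computable_mul; last by computable_proj.
by apply: (computable_comp (g := m)); computable_proj.
Qed.

Lemma computable_nth `{encodable X, encodable T} d (s : X -> seq T) (n : X -> nat) : computable s -> computable n ->
  computable (fun x => nth d (s x) (n x)).
Proof.
move=> cs cn; apply: (computable_ext (f := fun x => head d (iter (n x) behead (s x)))).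
  move=> x; have drop_iter k (u : seq T) : iter k behead u = drop k u.
    by elim: k u => [|k IH] u; rewrite ?drop0 // iterSr IH; case: u.
  by rewrite drop_iter -nth0 nth_drop addn0.
apply: computable_head; apply: (computable_iter (f := fun x => behead)) => //.
by apply: computable_behead; computable_proj.
Qed.

Lemma computable_iota `{encodable X} (n : X -> nat) :
  computable n -> computable (fun x => iota 0 (n x)).
Proof.
move=> cn.
apply: (computable_ext (f := fun x => iter (n x) (fun l => 0 :: map succn l) [::])).
  by move=> x; elim: (n x) => //= k ->; rewrite -[1]addn0 iotaDl; congr (_ :: _);
    apply: eq_map.
apply: (computable_iter (f := fun x l => 0 :: map succn l)) => //;
  last exact: computable_cst.
apply: computable_cons; first exact: computable_cst.
by apply: (computable_map (f := fun x => succn)); [apply: computable_succ|];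
  computable_proj.
Qed.

(** Equality is to be decided on arbitrary computable arguments, so that the property
passes to products and lists. *)
Definition computable_eq (T : eqType) {eT : encodable T} : Prop :=
  forall X (eX : encodable X) (s t : X -> T),
    computable s -> computable t -> computable (fun x => s x == t x).

Arguments computable_eq T {eT}.

Lemma computable_eq_nat : computable_eq nat.
Proof.
move=> X eX m n cm cn.
apply: (computable_ext (f := fun x =>
  nilp (iota 0 (m x - n x)) && nilp (iota 0 (n x - m x)))).
  by move=> x; rewrite /nilp !size_iota [RHS]eqn_leq.
by apply: computable_andb; apply: computable_nilp; apply: computable_iota;
  apply: computable_sub.
Qed.

Lemma computable_eq_bool : computable_eq bool.
Proof.
move=> X eX b c cb cc.
apply: (computable_ext (f := fun x => if b x then c x else ~~ c x)).
  by move=> x; case: (b x) (c x) => [] [].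
by apply: computable_if => //; apply: computable_negb.
Qed.

Lemma computable_eq_prod (T U : eqType) (eT : encodable T) (eU : encodable U) :
  computable_eq T -> computable_eq U -> computable_eq (T * U)%type.
Proof.
move=> dT dU X eX s t cs ct.
apply: (computable_ext (f := fun x => ((s x).1 == (t x).1) && ((s x).2 == (t x).2))) =>
  //.
by apply: computable_andb; [apply: dT | apply: dU]; computable_proj.
Qed.

(** The second list is consumed while the first is traversed; [d] is only read off an
exhausted list, where the test has already failed. *)
Lemma computable_eq_seq (T : eqType) (eT : encodable T) (d : T) :
  computable_eq T -> computable_eq (seq T).
Proof.
move=> dT X eX s t cs ct.
pose f (st : bool * seq T) a :=
  ([&& st.1, ~~ nilp st.2 & head d st.2 == a], behead st.2).
have fE u v b : (foldl f (b, v) u).1 && nilp (foldl f (b, v) u).2 = b && (u == v).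
  elim: u v b => [|a u IH] v b; first by rewrite /= /nilp size_eq0 eq_sym.
  rewrite -[foldl f _ _]/(foldl f ([&& b, ~~ nilp v & head d v == a], behead v) u).
  rewrite IH; case: v => [|c v] /=; first by rewrite andbF.
  by rewrite eqseq_cons eq_sym -andbA.
apply: (computable_ext (f := fun x => (foldl f (true, t x) (s x)).1 &&
                                nilp (foldl f (true, t x) (s x)).2)).
  by move=> x; rewrite [LHS]fE.
have cf : computable (fun x => foldl f (true, t x) (s x)).
  apply: (computable_foldl (f := fun x => f)) => //; last first.
    by apply: computable_pair => //; apply: computable_cst.
  apply: computable_pair; last by apply: computable_behead; computable_proj.
  apply: computable_andb; first by computable_proj.
  apply: computable_andb.
    by apply: computable_negb; apply: computable_nilp; computable_proj.
  by apply: dT; [apply: computable_head|]; computable_proj.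
apply: computable_andb; first by computable_proj.
by apply: computable_nilp; computable_proj.
Qed.

Lemma computable_eq_option (T : eqType) (eT : encodable T) (d : T) :
  computable_eq T -> computable_eq (option T).
Proof.
move=> dT X eX s t cs ct; pose f := oapp (cons^~ [::]) ([::] : seq T).
apply: (computable_ext (f := fun x => f (s x) == f (t x))).
  by move=> x; case: (s x) (t x) => [a|] [b|] //; rewrite [LHS]eqseq_cons andbT.
by apply: (computable_eq_seq d dT);
  [apply: computable_recode cs | apply: computable_recode ct].
Qed.

Lemma computable_mem (T : eqType) (eT : encodable T) X (eX : encodable X)
    (a : X -> T) (s : X -> seq T) :
  computable_eq T -> computable a -> computable s -> computable (fun x => a x \in s x).
Proof.
move=> dT ca cs.
apply: (computable_ext (f := fun x => foldr (fun c b => (a x == c) || b) false (s x))).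
  by move=> x; elim: (s x) => //= c u ->; rewrite inE.
apply: (computable_foldr (f := fun x c b => (a x == c) || b)) => //;
  last exact: computable_cst.
apply: computable_orb; last by computable_proj.
by apply: dT; [apply: (computable_comp (g := a)) |]; computable_proj.
Qed.

Lemma computable_ohead `{encodable X, encodable T}
    (s : X -> seq T) : computable s -> computable (fun x => ohead (s x)).
Proof.
move=> [p hp]; exists (PIf p (PCons (PSeq p PHead) PNil) PNil) => x; move: (hp x).
case: (s x) => [|a t] hs; first by apply: exec_if_false hs _; constructor.
apply: exec_if_true (hs) _; apply: exec_cons; last exact: exec_nil.
by apply: exec_seq hs _; apply: exec_head.
Qed.

(** * The search, as a computable function *)

Section Search.

Definition prefixes (T : Type) (w : seq T) : seq (seq T) :=
  foldr (fun x ps => [::] :: map (cons x) ps) [:: [::]] w.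

(** Each step puts one letter in front, and the empty word keeps the shorter words in
the list. *)
Definition short_words (T : Type) (alphabet : seq T) n : seq (seq T) :=
  iter n (fun ws => [::] :: flatten (map (fun x => map (cons x) ws) alphabet))
    [:: [::]].

Implicit Types (f : seq (seq (letter nat))) (w : seq (letter nat)).

Definition letter_image f (x : letter nat) : seq (letter nat) :=
  orient x.2 (nth [::] f x.1).

Definition same_images fs w : bool :=
  all (fun f => all (fun g => ext (letter_image f) w == ext (letter_image g) w) fs) fs.

(** Comparison with [reduce w] tests that [w] is reduced, and minimality is tested on
all prefixes of [w]. *)
Definition is_primitive fs w : bool :=
  [&& reduce w == w, w != [::], same_images fs w &
      all (fun p => [|| p == [::], p == w | ~~ same_images fs p]) (prefixes w)].

Definition letters n : seq (letter nat) :=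
  flatten (map (fun i => [:: (i, false); (i, true)]) (iota 0 n)).

(** The input is the size of the source alphabet, the size of the target alphabet and
the list of morphisms.  The total length of all given words bounds the length of
each of them. *)
Definition solve (t : nat * (nat * seq (seq (seq (letter nat))))) :
    seq (seq (letter nat)) :=
  select (is_primitive t.2.2)
    (short_words (letters t.1)
      (family_bound (size (flatten (flatten t.2.2))) (size (letters t.1))
                    (size t.2.2))).

End Search.

#[global] Instance encodable_letter : encodable (letter nat) :=
  @encodable_prod nat bool _ _.

Section Computability.

Let d : letter nat := (0, false).

Lemma computable_eq_letter : computable_eq (letter nat).
Proof. exact: computable_eq_prod computable_eq_nat computable_eq_bool. Qed.

Let computable_eq_word := computable_eq_seq d computable_eq_letter.

Lemma computable_letter_inv `{encodable X} (x : X -> letter nat) :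
  computable x -> computable (fun y => letter_inv (x y)).
Proof.
move=> cx; apply: (@computable_pair _ _ _ _ _ _ (fun y => (x y).1) (fun y => ~~ (x y).2)).
  exact: (@computable_fst _ nat bool).
by apply: computable_negb; apply: (@computable_snd _ nat bool).
Qed.


Lemma computable_cons_reduce `{encodable X} (x : X -> letter nat)
    (w : X -> seq (letter nat)) :
  computable x -> computable w -> computable (fun y => cons_reduce (x y) (w y)).
Proof.
move=> cx cw; apply: (computable_ext (f := fun y => if nilp (w y) then [:: x y] else
  if head d (w y) == letter_inv (x y) then behead (w y) else x y :: w y)).
  by move=> y; case: (w y).
apply: computable_if; first exact: computable_nilp.
  by apply: computable_cons => //; apply: computable_cst.
apply: computable_if; last exact: computable_cons.
  by apply: computable_eq_letter; [apply: computable_head|apply: computable_letter_inv].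
exact: computable_behead.
Qed.

Lemma computable_word_inv `{encodable X} (w : X -> seq (letter nat)) :
  computable w -> computable (fun y => word_inv (w y)).
Proof.
move=> cw; apply: computable_rev.
apply: (computable_map (f := fun y x => letter_inv x)) => //.
by apply: computable_letter_inv; computable_proj.
Qed.

Lemma computable_prefixes `{encodable X, encodable T} (w : X -> seq T) :
  computable w -> computable (fun x => prefixes (w x)).
Proof.
move=> cw; apply: (computable_foldr
  (f := fun x (a : T) (ps : seq (seq T)) => [::] :: map (cons a) ps)) => //.
  apply: computable_cons; first exact: computable_cst.
  apply: (computable_map (f := fun (y : X * (seq (seq T) * T)) (u : seq T) =>
    y.2.2 :: u)).
    by apply: computable_cons; computable_proj.
  by computable_proj.
exact: computable_cst.
Qed.

Lemma computable_short_words `{encodable X, encodable T} (s : X -> seq T) (n : X -> nat) :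
  computable s -> computable n -> computable (fun x => short_words (s x) (n x)).
Proof.
move=> cs cn; apply: (computable_iter (f := fun x (ws : seq (seq T)) =>
   [::] :: flatten (map (fun a => map (cons a) ws) (s x)))) => //;
     last exact: computable_cst.
apply: computable_cons; first exact: computable_cst.
apply: computable_flatten.
apply: (computable_map (f := fun (y : X * seq (seq T)) (a : T) => map (cons a) y.2)).
  apply: (computable_map (f := fun (y : X * seq (seq T) * T) (u : seq T) => y.2 :: u)).
    by apply: computable_cons; computable_proj.
  by computable_proj.
by apply: (computable_comp (g := s)); computable_proj.
Qed.

Lemma computable_letters `{encodable X} (n : X -> nat) :
  computable n -> computable (fun x => letters (n x)).
Proof.
move=> cn; apply: computable_flatten.
apply: (computable_map (f := fun x (i : nat) => [:: (i, false);
  (i, true)] : seq (letter nat))).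
  have cp b : computable (fun y : X * nat => (y.2, b) : letter nat).
    by apply: (@computable_pair _ nat bool); [computable_proj | apply: computable_cst].
  by do ![apply: computable_cons => //]; apply: computable_cst.
exact: computable_iota.
Qed.

Lemma computable_family_bound `{encodable X} (L N k : X -> nat) :
  computable L -> computable N -> computable k ->
  computable (fun x => family_bound (L x) (N x) (k x)).
Proof.
move=> cL cN ck; apply: (computable_iter (f := fun x b =>
  b * pair_bound (N x) (b * L x))) => //.
  have cL' : computable (fun y : X * nat => L y.1).
    by apply: (computable_comp (g := L)); computable_proj.
  have cN' : computable (fun y : X * nat => N y.1).
    by apply: (computable_comp (g := N)); computable_proj.
  have cs : computable (fun y : X * nat => (N y.1 * (y.2 * L y.1)).+1).
    apply: computable_succ; apply: computable_mul => //.
    by apply: computable_mul => //; computable_proj.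
  apply: computable_mul; first by computable_proj.
  apply: computable_exp => //; apply: computable_succ; apply: computable_exp.
    exact: computable_succ.
  by apply: computable_mul => //; apply: computable_mul => //; apply: computable_cst.
exact: computable_cst.
Qed.

Lemma computable_select `{encodable X} (b : X -> seq (letter nat) -> bool)
    (ws : X -> seq (seq (letter nat))) :
  computable (fun y : X * seq (letter nat) => b y.1 y.2) -> computable ws ->
  computable (fun x => select (b x) (ws x)).
Proof.
move=> cb cws; apply: (computable_foldl (f := fun x acc w =>
  if b x w && (ohead w \notin end_heads acc) then w :: acc else acc)) => //;
    last exact: computable_cst.
apply: computable_if.
- apply: computable_andb; first by apply: (computable_uncurry cb); computable_proj.
  apply: computable_negb; apply: computable_mem.
  + exact: computable_eq_option d computable_eq_letter.
  + by apply: computable_ohead; computable_proj.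
  apply: computable_flatten.
  apply: (computable_map (f := fun _ (u : seq (letter nat)) => [:: ohead u;
    ohead (word_inv u)])).
    apply: computable_cons; first by apply: computable_ohead; computable_proj.
    apply: computable_cons; last exact: computable_cst.
    apply: computable_ohead; apply: computable_rev.
    apply: (computable_map (f := fun y x => letter_inv x)); last by computable_proj.
    by apply: (computable_comp (g := @letter_inv nat));
      [computable_proj | apply: computable_letter_inv; exact: computable_id].
  by computable_proj.
- by apply: computable_cons; computable_proj.
- by computable_proj.
Qed.

Lemma computable_letter_image `{encodable X}
    (f : X -> seq (seq (letter nat))) (x : X -> letter nat) :
  computable f -> computable x -> computable (fun y => letter_image (f y) (x y)).
Proof.
move=> cf cx.
have cw : computable (fun y => nth [::] (f y) (x y).1).
  by apply: computable_nth => //; apply: (@computable_fst _ nat bool).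
apply: computable_if; first exact: (@computable_snd _ nat bool).
  exact: computable_word_inv.
exact: cw.
Qed.


Lemma computable_ext_image `{encodable X}
    (f : X -> seq (seq (letter nat))) (w : X -> seq (letter nat)) :
  computable f -> computable w -> computable (fun y => ext (letter_image (f y)) (w y)).
Proof.
move=> cf cw; apply: computable_flatten.
apply: (computable_map (f := fun y x => letter_image (f y) x)) => //.
apply: computable_letter_image; last by computable_proj.
by apply: (computable_comp (g := f)); computable_proj.
Qed.


Lemma computable_same_images `{encodable X} (fs : X -> seq (seq (seq (letter nat))))
    (w : X -> seq (letter nat)) :
  computable fs -> computable w -> computable (fun y => same_images (fs y) (w y)).
Proof.
move=> cfs cw; apply: (computable_all (f := fun y f =>
  all (fun g => ext (letter_image f) (w y) == ext (letter_image g) (w y)) (fs y))) => //.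
apply: (computable_all
  (f := fun (y : X * seq (seq (letter nat))) g =>
     ext (letter_image y.2) (w y.1) == ext (letter_image g) (w y.1))); last first.
  by apply: (computable_comp (g := fs)); computable_proj.
by apply: computable_eq_word; apply: computable_ext_image;
  try (by computable_proj); apply: (computable_comp (g := w)); computable_proj.
Qed.


Lemma computable_is_primitive `{encodable X} (fs : X -> seq (seq (seq (letter nat))))
    (w : X -> seq (letter nat)) :
  computable fs -> computable w -> computable (fun y => is_primitive (fs y) (w y)).
Proof.
move=> cfs cw.
apply: computable_andb.
  apply: computable_eq_word => //.
  apply: (computable_foldr (f := fun _ => @cons_reduce nat)) => //;
    last exact: computable_cst.
  by apply: computable_cons_reduce; computable_proj.
apply: computable_andb.
  by apply: computable_negb; apply: computable_eq_word => //; apply: computable_cst.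
apply: computable_andb; first exact: computable_same_images.
apply: (computable_all (f := fun y p =>
  [|| p == [::], p == w y | ~~ same_images (fs y) p])); last exact: computable_prefixes.
apply: computable_orb; first by apply: computable_eq_word;
  [computable_proj | apply: computable_cst].
apply: computable_orb.
  by apply: computable_eq_word; first computable_proj;
    apply: (computable_comp (g := w)); computable_proj.
apply: computable_negb; apply: computable_same_images; last by computable_proj.
by apply: (computable_comp (g := fs)); computable_proj.
Qed.


Lemma computable_solve : computable solve.
Proof.
have c1 : computable (fun t : nat * (nat * seq (seq (seq (letter nat)))) => letters t.1).
  by apply: computable_letters; computable_proj.
apply: (computable_select (b := fun t => is_primitive t.2.2)).
  by apply: computable_is_primitive; computable_proj.
apply: computable_short_words => //; apply: computable_family_bound.
- by apply: computable_size; do 2!apply: computable_flatten; computable_proj.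
- exact: computable_size.
- by apply: computable_size; computable_proj.
Qed.

End Computability.

(** * Correctness of the search *)

Section SearchSpace.
Variables (T U : eqType).
Implicit Types (w p : seq T) (s : seq T).

Lemma mem_prefixes p w : (p \in prefixes w) = prefix p w.
Proof.
elim: w p => [|x w IH] [|y p] //=; rewrite !inE //=.
apply/mapP/andP => [[q qw [-> ->]]|[/eqP -> pw]]; first by rewrite -IH.
by exists p => //; rewrite IH.
Qed.

Lemma mem_short_words s w n :
  (forall x, x \in s) -> size w <= n -> w \in short_words s n.
Proof.
move=> full; elim: n w => [|n IH] [|x w] //= le; rewrite !inE //=.
by apply/flattenP; exists (map (cons x) (short_words s n)); apply: map_f => //; apply: IH.
Qed.

Variable h : T -> U.

Lemma prefixes_map w : prefixes (map h w) = map (map h) (prefixes w).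
Proof. by elim: w => //= x w ->; rewrite -!map_comp. Qed.

Lemma short_words_map s n :
  short_words (map h s) n = map (map h) (short_words s n).
Proof.
elim: n => //= n ->; rewrite map_flatten -!map_comp; congr (_ :: flatten _).
by apply: eq_map => x /=; rewrite -!map_comp.
Qed.

End SearchSpace.

Lemma all_In T (b : pred T) s : all b s <-> forall x, List.In x s -> b x.
Proof.
elim: s => //= a s IH; split=> [/andP[ba /IH bs] x [<-|]|bs]; rewrite ?ba; auto.
by rewrite bs; [apply/IH => x ix; apply: bs; right | left].
Qed.

Lemma mem_In (T : eqType) (x : T) s : List.In x s -> x \in s.
Proof. by elim: s => //= a s IH [->|/IH]; rewrite inE ?eqxx // => ->; rewrite orbT. Qed.

Lemma size_mem_flatten (T : eqType) (u : seq T) ss :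
  u \in ss -> size u <= size (flatten ss).
Proof.
elim: ss => //= v ss IH; rewrite inE size_cat => /orP[/eqP<-|/IH le].
  exact: leq_addr.
exact: leq_trans le (leq_addl _ _).
Qed.

Section Numbering.
Variable A : finType.

(** The numbering of letters that underlies their encoding. *)
Definition number_letter (x : letter A) : letter nat := (nat_of_ord (enum_rank x.1), x.2).

Local Notation num := (map number_letter).

Lemma number_letter_inj : injective number_letter.
Proof. by move=> [a b] [c d] [/val_inj/enum_rank_inj-> ->]. Qed.

Lemma num_word_inv w : num (word_inv w) = word_inv (num w).
Proof. by rewrite /word_inv map_rev -!map_comp. Qed.

Lemma num_reduced w : (reduce (num w) == num w) = reduced w.
Proof.
have -> : (reduce (num w) == num w) = reduced (num w).
  by apply/eqP/idP => [<-|/reduceE//]; apply: reduce_reduced.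
rewrite /reduced sorted_map; apply: eq_sorted => x y /=.
by rewrite -(inj_eq number_letter_inj).
Qed.

Definition alphabet : seq (letter A) :=
  flatten (map (fun a => [:: (a, false); (a, true)]) (enum A)).

Lemma mem_alphabet x : x \in alphabet.
Proof.
case: x => a b; apply/flattenP; exists [:: (a, false); (a, true)].
  by apply: map_f; rewrite mem_enum.
by case: b; rewrite !inE eqxx ?orbT.
Qed.

Lemma num_alphabet : letters #|A| = num alphabet.
Proof.
rewrite /letters /alphabet map_flatten -map_comp.
have -> : iota 0 #|A| = map (fun a : A => nat_of_ord (enum_rank a)) (enum A).
  apply: (@eq_from_nth _ 0) => [|i]; first by rewrite size_iota size_map -cardE.
  rewrite size_iota => lti.
  have a0 : A by case: (pickP A) lti => [a//|/eq_card0->].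
  rewrite nth_iota // (nth_map a0) -?cardE // add0n.
  by rewrite -[i]/(val (Ordinal lti)) -enum_val_nth enum_valK.
by rewrite -map_comp.
Qed.

Lemma size_letters n : size (letters n) = n * 2.
Proof.
rewrite /letters size_flatten /shape -map_comp -[in RHS](size_iota 0 n).
by elim: (iota 0 n) => //= _ s ->; rewrite mulSn.
Qed.

(** The choice of words compares letters only for equality. *)
Lemma select_num (b : pred (seq (letter nat))) ws :
  select b (map num ws) = map num (select (fun w => b (num w)) ws).
Proof.
rewrite /select -[X in foldl _ X]/(map num [::]).
elim: ws [::] => //= w ws IH acc; rewrite -IH; congr foldl.
have -> : (ohead (num w) \in end_heads (map num acc)) = (ohead w \in end_heads acc).
  have ohead_num u : ohead (num u) = omap number_letter (ohead u) by case: u.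
  have -> : end_heads (map num acc) = map (omap number_letter) (end_heads acc).
    rewrite /end_heads map_flatten -!map_comp; congr flatten; apply: eq_map => u /=.
    by rewrite -num_word_inv !ohead_num.
  rewrite ohead_num mem_map //.
  by apply: inj_omap; apply: number_letter_inj.
by case: ifP.
Qed.

Lemma encode_num w : encode (num w) = encode_word w.
Proof. by rewrite /encode /encodable_seq /encode_word -map_comp. Qed.

End Numbering.

Section NumberedMorphisms.
Variables Sigma Delta : finType.
Local Notation morphism := {multiplicative free_group Sigma -> free_group Delta}.
Implicit Types (f : morphism) (s : seq morphism).

Definition number_morphism f : seq (seq (letter nat)) :=
  [seq map (@number_letter Delta) (fg_word (f (fg_letter (a, false)))) | a <- enum Sigma].

Lemma letter_image_number f x :
  letter_image (number_morphism f) (number_letter x) = map (@number_letter Delta) (letter_word f x).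
Proof.
rewrite /letter_image /number_morphism /= (nth_map x.1) -?cardE ?ltn_ord //.
rewrite -enum_val_nth enum_rankK -/(letter_word f (x.1, false)).
case: x => a [] //=; rewrite -num_word_inv.
by have [<- _] := letter_word_equivariant f.
Qed.

Lemma ext_letter_image_number f w :
  ext (letter_image (number_morphism f)) (map (@number_letter Sigma) w) =
  map (@number_letter Delta) (ext (letter_word f) w).
Proof. by elim: w => //= x w IH; rewrite !ext_cons map_cat -IH letter_image_number. Qed.

Definition letter_words s : set (letter Sigma -> seq (letter Delta)) :=
  (@letter_word Sigma Delta @` (fun f => List.In f s))%classic.

Lemma same_images_number s w :
  same_images (map number_morphism s) (map (@number_letter Sigma) w) <->
  agreeing (letter_words s) w.
Proof.
have step (b : pred (seq (seq (letter nat)))) : all b (map number_morphism s) <->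
    forall f, List.In f s -> b (number_morphism f) by rewrite all_map all_In.
split=> [e _ _ [f fs <-] [g gs <-]|e].
  move: ((step _).1 ((step _).1 e f fs) g gs) => /eqP.
  by rewrite !ext_letter_image_number; apply: (inj_map (@number_letter_inj Delta)).
apply/step => f fs; apply/step => g gs; rewrite !ext_letter_image_number.
by apply/eqP; congr map; apply: e; [exists f | exists g].
Qed.

(** The test on numbered words decides primitivity, as the numbering is injective. *)
Lemma is_primitive_number s w :
  is_primitive (map number_morphism s) (map (@number_letter Sigma) w) <->
  primitive (agreeing (letter_words s)) w.
Proof.
rewrite /is_primitive num_reduced -size_eq0 size_map size_eq0; split.
  move=> /and4P[rw nw /same_images_number ew /allP pw]; split=> // p pp np Ep.
  have := pw (map (@number_letter Sigma) p); rewrite prefixes_map map_f ?mem_prefixes //.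
  rewrite -size_eq0 size_map size_eq0 (negPf np) /= => /(_ isT)/orP[/eqP|/negP[]].
    by apply: (inj_map (@number_letter_inj Sigma)).
  exact/same_images_number.
move=> [rw Ew nw min]; rewrite rw nw /=; apply/andP; split.
  exact/same_images_number.
apply/allP => q; rewrite prefixes_map => /mapP[p]; rewrite mem_prefixes => pp -> {q}.
rewrite -size_eq0 size_map size_eq0; case: eqVneq => //= np.
case: (boolP (same_images _ _)) => [/same_images_number Ep|]; rewrite ?orbT //.
by rewrite (min p) ?eqxx.
Qed.

Lemma encode_input_number s :
  encode_input s = encode (#|Sigma|, (#|Delta|, map number_morphism s)).
Proof.
congr (Defs.Cons _ (Defs.Cons _ (encode_seq _))).
rewrite -map_comp; apply: eq_map => f; congr encode_seq.
rewrite -[RHS]map_comp; apply: eq_map => a; exact/esym/encode_num.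
Qed.

Lemma size_letter_word s f x : List.In f s ->
  size (letter_word f x) <= size (flatten (flatten (map number_morphism s))).
Proof.
move=> fs; rewrite -(size_map (@number_letter Delta)) -letter_image_number.
have -> : size (letter_image (number_morphism f) (number_letter x)) =
    size (letter_image (number_morphism f) (number_letter (x.1, false))).
  by case: x => a [] //=; rewrite /letter_image /= size_rev size_map.
apply: size_mem_flatten; apply/flattenP; exists (number_morphism f).
  by apply: mem_In; apply: List.in_map.
rewrite letter_image_number; apply/mapP; exists x.1 => //; exact: mem_enum.
Qed.

End NumberedMorphisms.

Section Conclusion.
Variables Sigma Delta : finType.
Local Notation morphism := {multiplicative free_group Sigma -> free_group Delta}.

Section Equaliser.
Variable S : set morphism.
Hypothesis immS : forall f, S f -> immersion f.
Let E := agreeing (@letter_word Sigma Delta @` S)%classic.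

Lemma equaliser_submonoid : lcp_submonoid E.
Proof. by apply: agreeing_submonoid => _ [f /immS/immersion_immersive ? <-]. Qed.

Lemma equaliser_word_inv w : E w -> E (word_inv w).
Proof.
move=> Ew _ _ [f Sf <-] [g Sg <-]; rewrite !ext_word_inv;
  try exact: letter_word_equivariant.
by congr word_inv; apply: Ew; [exists f | exists g].
Qed.

(** Both halves of the result follow from this, with different tests [b] and lists
[ws] of candidates. *)
Lemma equaliser_basis (b : pred (seq (letter Sigma))) (ws : seq (seq (letter Sigma))) :
  (forall w, b w <-> primitive E w) -> (forall w, primitive E w -> w \in ws) ->
  exists psi : {multiplicative free_group 'I_(size (select b ws)) -> free_group Sigma},
    [/\ immersion psi, range psi = set_equaliser S &
        forall i, fg_word (psi (fg_letter (i, false))) = nth [::] (select b ws) i].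
Proof.
move=> bP wsP.
exists (basis_map equaliser_submonoid equaliser_word_inv ws bP); split.
- exact: basis_map_immersion.
- rewrite basis_map_range //; apply/seteqP; split=> w /=.
  + by move/(set_equaliserP _ immS).
  + by move/(set_equaliserP _ immS).
- move=> i; exact: fg_extension_letter.
Qed.

End Equaliser.

End Conclusion.

Lemma encode_morphism_num (A : finType) (acc : seq (seq (letter A))) n
    (psi : {multiplicative free_group 'I_n -> free_group A}) : n = size acc ->
  (forall i, fg_word (psi (fg_letter (i, false))) = nth [::] acc i) ->
  encode_morphism psi = encode (map (map (@number_letter A)) acc).
Proof.
move=> en e; congr encode_seq; rewrite -[RHS]map_comp.
transitivity (map (@encode_word A) acc); last first.
  by apply: eq_map => w; rewrite -encode_num.
rewrite (eq_map (g := fun i : 'I_n => encode_word (nth [::] acc i))) => [|i];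
  last by rewrite e.
rewrite -{2}(mkseq_nth [::] acc) /mkseq -en -val_enum_ord -!map_comp.
exact: eq_map.
Qed.

Theorem theorem3 :
  (forall (Sigma Delta : finType)
     (S : set {multiplicative free_group Sigma -> free_group Delta}),
     (forall f, S f -> immersion f) ->
     exists (SigmaS : finType)
       (psi : {multiplicative free_group SigmaS -> free_group Sigma}),
       immersion psi /\ range psi = set_equaliser S)
  /\
  (exists p : program,
     forall (Sigma Delta : finType)
       (s : seq {multiplicative free_group Sigma -> free_group Delta}),
       (forall f, List.In f s -> immersion f) ->
       exists (n : nat)
         (psi : {multiplicative free_group 'I_n -> free_group Sigma}),
         exec p (encode_input s) (encode_morphism psi) /\
         immersion psi /\
         range psi = set_equaliser (fun f => List.In f s)).
Proof.
split=> [Sigma Delta S immS|].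
  (* Without computability the finitely many candidates can be chosen directly. *)
  set E := agreeing (@letter_word Sigma Delta @` S)%classic.
  have subE : lcp_submonoid E := equaliser_submonoid immS.
  have [|w [rw Ew nw min]|psi [ipsi rpsi _]] := equaliser_basis immS
    (b := fun w => `[<primitive E w>]) (ws := map (base E) (enum {: letter Sigma})).
  - by move=> w; split=> /asboolP.
  - case: w rw Ew nw min => // x w rw Ew nw min.
    have [bx hx] := primitive_ex subE Ew rw.
    have -> : x :: w = base E x by apply: (primitive_eq subE) => //; rewrite hx.
    by apply: map_f; rewrite mem_enum.
  by exists 'I_(size (select (fun w =>
    `[<primitive E w>]) [seq base E x | x <- enum {: letter Sigma}])), psi.
have [p hp] := computable_solve; exists p => Sigma Delta s imms.
set E := agreeing (letter_words s).
have subE : lcp_submonoid E := equaliser_submonoid imms.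
set fs := map (@number_morphism Sigma Delta) s.
pose b w := is_primitive fs (map (@number_letter Sigma) w).
pose ws := short_words (alphabet Sigma) (family_bound (size (flatten (flatten fs)))
  (size (letters #|Sigma|)) (size fs)).
have [|w bw|psi [ipsi rpsi epsi]] := equaliser_basis imms (b := b) (ws := ws).
- by move=> w; apply: is_primitive_number.
- apply: mem_short_words; first exact: mem_alphabet.
  have [_ Ew nw _] := bw; case: w => [//|x w] in bw Ew nw *.
  have EE u : E u <-> agreeing (fun h => List.In h (map (@letter_word Sigma Delta) s)) u.
    split=> Eu h k.
      by move=> /List.in_map_iff[f [<- fs_]] /List.in_map_iff[g [<- gs]]; apply: Eu;
        [exists f|exists g].
    by move=> [f fs_ <-] [g gs <-]; apply: Eu; apply: List.in_map.
  have [||||v [Ev hv sv]] := family_solution_bound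
    (s := map (@letter_word Sigma Delta) s) (L := size (flatten (flatten fs)))
    (x := x) (v := x :: w).
  + by move=> _ /List.in_map_iff[f [<- /imms/immersion_immersive]].
  + by move=> _ /List.in_map_iff[f [<- fs_]] y; apply: size_letter_word.
  + exact/EE.
  + by [].
  apply: leq_trans (size_primitive subE bw erefl ((EE v).2 Ev) hv) _.
  by rewrite size_letters size_map -(size_map (@letter_word Sigma Delta)) -card_bool -card_prod.
exists (size (select b ws)), psi; split=> //.
rewrite (encode_morphism_num erefl epsi) encode_input_number -select_num -short_words_map -num_alphabet.
exact: hp.
Qed.
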